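(* Let $\bar u$ denote the solution of $\mathcal P=\inf_{f\in\mathcal C}I[f]$, and for each $k\in\mathbb N$ let $\bar v_k$ be the piecewise affine convex function built from the solution $(\bar v^k,\bar D^k)$ of the discretized program $\mathcal P_k$. Then the sequence $\{\bar v_k\}$ is minimizing for problem $\mathcal P$, in the sense that $$\lim_{k\to\infty} I[\bar v_k]=I[\bar u]=\inf_{f\in\mathcal C}I[f].$$
   Context: Let $\Theta=[a,b]^n\subset\mathbb R^n$ with $a<b$, let $Q\subset\mathbb R^n$ be non-empty, convex and compact, let $C:\mathbb R^n\to\mathbb R$ be strictly convex and $C^1$, and let $L(\theta,z,p)=z-\theta\cdot p+C(p)$. Let $\mathcal C$ be the set of continuous convex functions $f:\Theta\to\mathbb R$ with $f\ge 0$, $\nabla f\in Q$ almost everywhere on $\Theta$, and $f(\theta_0)=0$ for some $\theta_0\in\Theta$. For a convex function $f$ on $\Theta$ put $I[f]=\int_\Theta L(\theta,f(\theta),\nabla f(\theta))\,d\theta$. The problem is $\mathcal P=\inf_{f\in\mathcal C}I[f]$, and $C$ is assumed to be such that it has a unique solution $\bar u\in\mathcal C$. Discretization. For $k\in\mathbb N$, partition $\Theta$ into $k^n$ equal cubes $\sigma_j^k$ ($1\le j\le k^n$) of volume $\|\Sigma_k\|=\left(\frac{b-a}{k}\right)^n$, and let $\theta_j=\theta_j^k$ be the center of $\sigma_j^k$. The program $\mathcal P_k$ is to minimize $$J_k(v,D)=\|\Sigma_k\|\sum_{i=1}^{k^n}L(\theta_i,v_i,D_i)$$ over all $v=(v_1,\dots,v_{k^n})\in\mathbb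 R^{k^n}$ and $D=(D_1,\dots,D_{k^n})$ with $D_i\in\mathbb R^n$ such that: (a) $v_i\ge 0$ for all $i$; (b) $D_i\in Q$ for all $i$; (c) $v_i-v_j+D_i\cdot(\theta_j-\theta_i)\le 0$ for all $i,j$. Its solution is denoted $(\bar v^k,\bar D^k)$, and $$\bar v_k(\theta)=\max_{1\le i\le k^n}\left(\bar v_i^k+\bar D_i^k\cdot(\theta-\theta_i)\right),\qquad\theta\in\Theta.$$ *)

(* Defs.v *)
From HB Require Import structures.
From mathcomp Require Import all_boot all_order all_algebra.
From mathcomp Require Import all_classical all_reals all_analysis.

Set Implicit Arguments.
Unset Strict Implicit.
Unset Printing Implicit Defensive.

Import Order.TTheory GRing.Theory Num.Theory.
Import numFieldNormedType.Exports.

Local Open Scope classical_set_scope.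
Local Open Scope ring_scope.

Definition measure_rV_display : measure_display.
Proof. exact. Qed.

Section measurable_rV.
Context {R : realType} {n : nat}.

Definition coord_rV (i : 'I_n) (x : 'rV[R]_n) : measurableTypeR R := x 0 i.

Let rV_set0 : g_sigma_preimage coord_rV set0.
Proof. exact: sigma_algebra0. Qed.

Let rV_setC A : g_sigma_preimage coord_rV A -> g_sigma_preimage coord_rV (~` A).
Proof. exact: sigma_algebraC. Qed.

Let rV_bigcup (F : _^nat) : (forall i, g_sigma_preimage coord_rV (F i)) ->
  g_sigma_preimage coord_rV (\bigcup_i (F i)).
Proof. exact: sigma_algebra_bigcup. Qed.

(* The product sigma-algebra on R^n, which is also the Borel one. *)
HB.instance Definition _ := @isMeasurable.Build measure_rV_display
  'rV[R]_n (g_sigma_preimage coord_rV) rV_set0 rV_setC rV_bigcup.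

Lemma measurable_coord_rV (i : 'I_n) : measurable_fun setT (coord_rV i).
Proof.
move=> _ Y mY; rewrite setTI; apply: sub_sigma_algebra => /=.
rewrite -bigcup_seq/=; exists i => /=; first by rewrite mem_index_enum.
by exists Y => //; rewrite setTI.
Qed.

Lemma measurable_fun_rVP d (T : measurableType d) (f : T -> 'rV[R]_n) :
  (forall i, measurable_fun setT (coord_rV i \o f)) -> measurable_fun setT f.
Proof.
move=> mf _ Y; rewrite setTI; move: Y.
apply: smallest_sub.
  split; rewrite /= ?preimage_set0//.
  - by move=> A mA; rewrite setTD -preimage_setC; exact: measurableC.
  - by move=> F mF; rewrite preimage_bigcup; exact: bigcup_measurable.
move=> A; rewrite -bigcup_seq/= => -[i _ [B mB <-]].
by have := mf i measurableT B mB; rewrite !setTI.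
Qed.

End measurable_rV.

Section lebesgue_rV.
Context {R : realType}.

Definition cons_rV n (p : measurableTypeR R * 'rV[R]_n) : 'rV[R]_n.+1 :=
  row_mx (p.1 : R)%:M p.2.

Lemma measurable_cons_rV n : measurable_fun setT (@cons_rV n).
Proof.
apply: measurable_fun_rVP => i.
have [j|j] := split_ordP (i : 'I_(1 + n)) => ij.
  rewrite (_ : _ \o _ = fst); first exact: measurable_fst.
  apply/funext => -[x y]; rewrite /coord_rV /cons_rV /= ij.
  by rewrite (@row_mxEl _ 1 1 n) mxE (ord1 j).
rewrite (_ : _ \o _ = coord_rV j \o snd).
  exact: measurableT_comp (measurable_coord_rV j) measurable_snd.
apply/funext => -[x y]; rewrite /coord_rV /cons_rV /= ij.
by rewrite (@row_mxEr _ 1 1 n).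
Qed.

Section step.
Context {n : nat} (m : {sigma_finite_measure set 'rV[R]_n -> \bar R}).

Definition lebesgue_step : set 'rV[R]_n.+1 -> \bar R :=
  pushforward (@lebesgue_measure R \x m)%E (@cons_rV n).

Let step_measure : {measure set 'rV[R]_n.+1 -> \bar R} :=
  measure_function_pushforward__canonical__measure_function_Measure
    (@lebesgue_measure R \x m)%E (@measurable_cons_rV n).

HB.instance Definition _ := isMeasure.Build _ _ _ lebesgue_step
  (measure0 step_measure) (@measure_ge0 _ _ _ step_measure)
  (@measure_semi_sigma_additive _ _ _ step_measure).

Let uncons_rV (x : 'rV[R]_n.+1) : measurableTypeR R * 'rV[R]_n :=
  (coord_rV ord0 x, rsubmx (x : 'rV[R]_(1 + n))).

Let measurable_uncons_rV : measurable_fun setT uncons_rV.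
Proof.
apply/measurable_fun_pairP; split; first exact: measurable_coord_rV.
apply: measurable_fun_rVP => i.
rewrite (_ : _ \o _ = coord_rV (rshift 1 i : 'I_n.+1)).
  exact: measurable_coord_rV.
by apply/funext => x; rewrite /coord_rV/= mxE.
Qed.

Let cons_rVK : cancel (@cons_rV n) uncons_rV.
Proof.
move=> [x y]; rewrite /uncons_rV /cons_rV /coord_rV /= row_mxKr.
congr pair.
have -> : (ord0 : 'I_n.+1) = lshift n (0 : 'I_1) by exact/val_inj.
by rewrite (@row_mxEl _ 1 1 n) mxE.
Qed.

Let lebesgue_step_sigma_finite : sigma_finite setT lebesgue_step.
Proof.
have /sigma_finiteP[F [FT ndF Foo]] := sigma_finiteT (@lebesgue_measure R).
have /sigma_finiteP[G [GT ndG Goo]] := sigma_finiteT m.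
exists (fun k => uncons_rV @^-1` (F k `*` G k)).
  apply/seteqP; split => // x _.
  have [i _ Fi] : (\bigcup_i F i) (uncons_rV x).1 by rewrite -FT.
  have [j _ Gj] : (\bigcup_i G i) (uncons_rV x).2 by rewrite -GT.
  exists (maxn i j) => //; split.
    by have /subsetPset := ndF _ _ (leq_maxl i j); exact.
  by have /subsetPset := ndG _ _ (leq_maxr i j); exact.
move=> k; have [mF Fk] := Foo k; have [mG Gk] := Goo k; split.
  rewrite -[X in measurable X]setTI; apply: measurable_uncons_rV => //.
  exact: measurableX.
rewrite /lebesgue_step /pushforward -comp_preimage.
rewrite (_ : _ \o _ = id); last by apply/funext => x; exact: cons_rVK.
by rewrite preimage_id product_measure1E// lte_mul_pinfty// ge0_fin_numE.
Qed.

HB.instance Definition _ := Measure_isSigmaFinite.Build _ _ _ lebesgue_step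
  lebesgue_step_sigma_finite.

End step.

(* Lebesgue measure on R^n: the n-fold product of the one on R. *)
Fixpoint lebesgue_rV n : {sigma_finite_measure set 'rV[R]_n -> \bar R} :=
  if n is m.+1 then lebesgue_step (lebesgue_rV m) else \d_(0 : 'rV[R]_0).

Lemma lebesgue_rV_box n (A : 'I_n -> set (measurableTypeR R)) :
  (forall i, measurable (A i)) ->
  lebesgue_rV n [set x | forall i, A i (x 0 i)] =
  (\prod_(i < n) lebesgue_measure (A i))%E.
Proof.
elim: n A => [|n IHn] A mA.
  rewrite big_ord0 /= diracE mem_set//=; by case.
rewrite big_ord_recl -IHn; last by move=> i; exact: mA.
have mB : measurable [set x : 'rV[R]_n | forall i, A (lift ord0 i) (x 0 i)].
  rewrite (_ : mkset _ =
      \bigcap_(i in [set: 'I_n]) (coord_rV i @^-1` A (lift ord0 i))).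
    apply: fin_bigcap_measurable => // i _.
    by rewrite -[X in measurable X]setTI; exact: measurable_coord_rV.
  by apply/seteqP; split => x /= h i; [move=> _|]; exact: h.
rewrite -product_measure1E//.
rewrite /= /lebesgue_step /pushforward; congr (product_measure1 _ _ _).
apply/seteqP; split=> -[x y] /=; rewrite /cons_rV /=.
  move=> h; split => [|i].
    have := h ord0.
    rewrite (_ : (ord0 : 'I_n.+1) = lshift n (0 : 'I_1)); last exact/val_inj.
    by rewrite (@row_mxEl _ 1 1 n) mxE.
  have := h (lift ord0 i).
  rewrite (_ : lift ord0 i = rshift 1 i :> 'I_(1 + n)); last exact/val_inj.
  by rewrite (@row_mxEr _ 1 1 n).
move=> [Ax Ay] i; have [j|j] := split_ordP (i : 'I_(1 + n)) => ->.
  rewrite (@row_mxEl _ 1 1 n) mxE (ord1 j) eqxx mulr1n.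
  by rewrite (_ : lshift n (0 : 'I_1) = ord0 :> 'I_n.+1)//; exact/val_inj.
rewrite (@row_mxEr _ 1 1 n).
by rewrite (_ : rshift 1 j = lift ord0 j :> 'I_n.+1); [exact: Ay|exact/val_inj].
Qed.

End lebesgue_rV.

Section vector_calculus.
Context {R : realType} {n : nat}.
Implicit Types (x y : 'rV[R]_n) (f : 'rV[R]_n -> R).

Definition dotv x y : R := \sum_(i < n) x 0 i * y 0 i.

Definition grad f x : 'rV[R]_n :=
  \row_(i < n) 'D_(delta_mx 0 i : 'rV[R]_n) f x.

Definition C1 f := (forall x, differentiable f x) /\ continuous (grad f).

Definition strictly_convex f := forall x y (t : R), x != y -> 0 < t < 1 ->
  f (t *: x + (1 - t) *: y) < t * f x + (1 - t) * f y.

End vector_calculus.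

Section problem.
Context {R : realType} {n : nat}.
Variables (a b : R) (Q : set 'rV[R]_n) (C : 'rV[R]_n -> R).
Implicit Types (f u : 'rV[R]_n -> R) (theta p : 'rV[R]_n) (z : R).

Definition Theta : set 'rV[R]_n := [set x | forall i, a <= x 0 i <= b].

Definition lagrangian theta z p : R := z - dotv theta p + C p.

(* The functions of the problem are total functions of which only the
   restriction to Theta matters: the boundary of Theta, where differentiability
   would see the values outside Theta, is negligible. *)
Definition admissible f :=
  [/\ {within Theta, continuous f},
      convex_function Theta f,
      forall x, Theta x -> 0 <= f x,
      {ae lebesgue_rV n,
         forall x, Theta x -> differentiable f x /\ Q (grad f x)} &
      exists2 theta0, Theta theta0 & f theta0 = 0].

Definition functional f : R :=
  \int[lebesgue_rV n]_(x in Theta) lagrangian x (f x) (grad f x).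

Definition solution u :=
  admissible u /\ forall f, admissible f -> functional u <= functional f.

Definition unique_solution u := solution u /\
  forall w, solution w -> forall x, Theta x -> w x = u x.

Section discretization.
Variable k : nat.

(* The k ^ n cubes are indexed by their positions along the n axes. *)
Definition grid := {ffun 'I_n -> 'I_k}.

Implicit Types (v : grid -> R) (D : grid -> 'rV[R]_n).

Definition center (j : grid) : 'rV[R]_n :=
  \row_(l < n) (a + ((j l)%:R + 2^-1) * ((b - a) / k%:R)).

Definition cube_volume : R := ((b - a) / k%:R) ^+ n.

Definition discrete_functional v D : R :=
  cube_volume * \sum_(i : grid) lagrangian (center i) (v i) (D i).

Definition feasible v D :=
  [/\ forall i, 0 <= v i,
      forall i, Q (D i) &
      forall i j, v i - v j + dotv (D i) (center j - center i) <= 0].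

Definition discrete_solution v D := feasible v D /\
  forall w E, feasible w E ->
    discrete_functional v D <= discrete_functional w E.

End discretization.

Definition affine_piece k (v : grid k -> R) (D : grid k -> 'rV[R]_n)
  (i : grid k) theta : R := v i + dotv (D i) (theta - center i).

(* The default value of the maximum is one of its terms, that of the first
   cube; this needs at least one subdivision, whence the successor. *)
Definition max_affine k (v : grid k.+1 -> R) (D : grid k.+1 -> 'rV[R]_n)
  theta : R :=
  \big[Num.max/affine_piece v D [ffun=> ord0] theta]_(i : grid k.+1)
    affine_piece v D i theta.

End problem.

(* Main.v *)
Require Import Defs.
From mathcomp Require Import all_boot all_order all_algebra.
From mathcomp Require Import all_classical all_reals all_analysis.
From mathcomp Require Import measurable_realfun ring lra.

Set Implicit Arguments.
Unset Strict Implicit.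
Unset Printing Implicit Defensive.

Import Order.TTheory GRing.Theory Num.Theory.
Import numFieldNormedType.Exports.

Local Open Scope classical_set_scope.
Local Open Scope ring_scope.

(** The argument is quantitative: it squeezes [I[v_k]] (with [v_k] the maximum
    of the affine pieces of the k-th discrete solution, and [h] the side of the
    cubes) between [I[ubar]] and itself up to errors that tend to 0, without
    extracting a convergent subsequence of the [v_k].

    Upper bound for the discrete value ([discrete_le_functional]).  Let [f] be
    admissible.  For almost every small vector [y], [f] is differentiable at all
    the shifted centers [center i + y], and by convexity the values and the
    gradients of [f] at these points satisfy the discrete constraints: shifting
    all the centers by the same vector does not change their differences.
    Hence the discrete minimum is at most the discrete functional at these
    data.  Averaging over [y] in a cube of side [h] turns the sum over the
    centers into [I[f]], up to an error O(h) that comes from the term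
    [theta . p] of the Lagrangian.

    Lower bound for [I[v_k]] ([functional_max_affine_ge]).  The function [v_k]
    is nonnegative at the centers and Lipschitz, so its minimum over Theta is at
    least - O(h).  Subtracting this minimum gives an admissible function, and
    the functional decreases by the minimum times the volume of Theta.

    Upper bound for [I[v_k]] ([functional_max_affine_le]).  On the cube of
    center [c], the gradient [g] of [v_k] at a point and the vector [D i] are
    subgradients of the same convex function at points that are O(h) apart.
    Comparing them with increments of step [s] bounds each [|g_l - D_l|] by the
    second difference of [v_k] at [c] with step [s] in the direction [l],
    divided by [s], plus O(h / s) ([subgradient_dist]).  The sum of these second
    differences over the grid telescopes to boundary terms
    ([second_difference_sum]).  With [s = m h] the average of [|g - D|] over
    the cubes is O(m / k + 1 / m), which is small for [m] large and then [k]
    large.  As [C] is Lipschitz on [Q] (a convex function with gradient bounded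
    on [Q]), [I[v_k]] exceeds the discrete value by the same order. *)

(** * Integrals and null sets *)

Section null_difference.
Context d (T : measurableType d) (R : realType).
Variable mu : {measure set T -> \bar R}.
Import HBNNSimple.

(** The integral of a nonnegative function, measurable or not. *)
Let nnint (f : T -> \bar R) := ereal_sup [set sintegral mu h |
  h in [set h : {nnsfun T >-> R} | forall x, ((h x)%:E <= f x)%E]].

Let le_nnint (f g : T -> \bar R) (N : set T) : measurable N -> mu N = 0%E ->
  (forall x, 0 <= g x)%E -> (forall x, ~ N x -> f x = g x) ->
  (nnint f <= nnint g)%E.
Proof.
move=> mN N0 g0 fg; apply: ge_ereal_sup => _ [h hf <-].
have mNC : measurable (~` N) by exact: measurableC.
pose h' := mul_nnsfun h (indic_nnsfun R mNC).
apply: ereal_sup_ubound; exists h'.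
  move=> x; rewrite /= mindicE; have [Nx|Nx] := pselect (N x).
    by rewrite memNset//= ?mulr0 ?g0//; apply.
  by rewrite mem_set// mulr1 -fg.
rewrite -!integralT_nnsfun; apply: ae_eq_integral => //.
- exact/measurable_EFinP/measurable_funP.
- exact/measurable_EFinP/measurable_funP.
- exists N; split => // x /=; apply: contra_notP => Nx _.
  by rewrite /= mindicE mem_set// mulr1.
Qed.

(** No measurability is asked of [h]: at the points where a function is not
    differentiable its gradient is arbitrary, so that the integrand of the
    functional may fail to be measurable on Theta.  The integral is blind to null
    sets all the same, as a simple function below the integrand may be set to 0
    there. *)
Lemma integral_setD_null (A H : set T) (h : T -> \bar R) :
  measurable A -> measurable H -> H `<=` A -> mu (A `\` H) = 0%E ->
  (\int[mu]_(x in A) h x = \int[mu]_(x in H) h x)%E.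
Proof.
move=> mA mH HA AH.
have mN : measurable (A `\` H) by exact: measurableD.
have E x : ~ (A `\` H) x -> (h \_ A) x = (h \_ H) x.
  move=> Nx; rewrite !patchE; case: ifPn => Ax; case: ifPn => Hx //.
    by case: Nx; split; [exact: set_mem|move/mem_set; rewrite (negbTE Hx)].
  by move: Ax; rewrite mem_set//; exact/HA/set_mem.
rewrite /integral -/(nnint _); congr (_ - _)%E; apply/eqP; rewrite eq_le;
  by apply/andP; split; apply: (le_nnint mN) => // x Nx;
    rewrite ?funeposE ?funenegE E.
Qed.

Lemma Rintegral_setD_null (A H : set T) (h : T -> R) :
  measurable A -> measurable H -> H `<=` A -> mu (A `\` H) = 0%E ->
  \int[mu]_(x in A) h x = \int[mu]_(x in H) h x.
Proof. by move=> mA mH HA AH; rewrite /Rintegral (integral_setD_null _ mA mH). Qed.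

Lemma measure_setD_null (A H : set T) : measurable A -> measurable H ->
  H `<=` A -> mu (A `\` H) = 0%E -> mu H = mu A.
Proof.
move=> mA mH HA AH.
have E : mu A = (mu (A `\` H) + mu (A `&` H))%E by exact: measureDI.
by rewrite E AH add0e setIidr.
Qed.

Lemma bounded_integrable (A : set T) (g : T -> R) (r K : R) : measurable A ->
  mu A = r%:E -> measurable_fun A g -> (forall x, A x -> `|g x| <= K) ->
  mu.-integrable A (EFin \o g).
Proof.
move=> mA muA mg gK; apply: measurable_bounded_integrable => //.
  by rewrite muA ltry.
exists K; split; first exact: num_real.
by move=> M KM x Ax; rewrite /= (le_trans (gK x Ax))// ltW.
Qed.

Lemma Rintegral_sum (I : Type) (s : seq I) (A : set T) (g : I -> T -> R) :
  measurable A -> (forall i, mu.-integrable A (EFin \o g i)) ->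
  mu.-integrable A (EFin \o (fun x => \sum_(i <- s) g i x)) /\
  \int[mu]_(x in A) (\sum_(i <- s) g i x) = \sum_(i <- s) \int[mu]_(x in A) g i x.
Proof.
move=> mA ig; elim: s => [|i s [IH1 IH2]].
  have E : (fun x => \sum_(i <- [::]) g i x) = (fun=> 0).
    by apply/funext => x; rewrite big_nil.
  rewrite E big_nil Rintegral_cst// mul0r; split => //.
  exact: integrable0.
have E : (fun x => \sum_(j <- i :: s) g j x) =
    (fun x => g i x + \sum_(j <- s) g j x).
  by apply/funext => x; rewrite big_cons.
rewrite E; split.
  exact: (integrableD mA (ig i) IH1).
by rewrite RintegralD// IH2 big_cons.
Qed.

End null_difference.
Arguments Rintegral_setD_null {d T R mu} A H h.

(** * Lebesgue measure on R^n *)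

Section geometry.
Context {R : realType} {n : nat}.
Implicit Types (x y c : 'rV[R]_n).

Lemma measurable_coord (i : 'I_n) :
  measurable_fun setT (fun x : 'rV[R]_n => x 0 i : R).
Proof. exact: measurable_coord_rV. Qed.

Lemma measurable_dotv c : measurable_fun setT (dotv c : 'rV[R]_n -> R).
Proof.
apply: measurable_sum => i; apply: measurable_funM => //.
exact: measurable_coord.
Qed.

Lemma measurable_box (A : 'I_n -> set R) : (forall i, measurable (A i)) ->
  measurable [set x : 'rV[R]_n | forall i, A i (x 0 i)].
Proof.
move=> mA; rewrite (_ : mkset _ =
    \bigcap_(i in [set: 'I_n]) ((fun x : 'rV[R]_n => x 0 i) @^-1` A i)).
  apply: fin_bigcap_measurable => // i _.
  by rewrite -[X in measurable X]setTI; exact: measurable_coord.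
by apply/seteqP; split => x /= h i; [move=> _|]; exact: h.
Qed.

End geometry.

Lemma dotv_row_mx {R : realType} n (c : 'rV[R]_(1 + n)) (t : R) (y : 'rV[R]_n) :
  dotv c (row_mx t%:M y : 'rV_(1 + n)) = c 0 ord0 * t + dotv (rsubmx c) y.
Proof.
rewrite /dotv big_split_ord/= big_ord1 row_mxEl mxE eqxx mulr1n; congr (c _ _ * _ + _).
  exact/val_inj.
by apply: eq_bigr => i _; rewrite row_mxEr mxE.
Qed.

(** By Fubini: if some coefficient other than the first one is nonzero, the slices
    at a fixed first coordinate are hyperplanes in one dimension less; otherwise
    the hyperplane is a box with one degenerate side. *)
Lemma hyperplane_null {R : realType} n (c : 'rV[R]_n) (r : R) : c != 0 ->
  lebesgue_rV n [set x | dotv c x = r] = 0%E.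
Proof.
elim: n c r => [|n IHn] c r c0.
  by case/negP: c0; apply/eqP/rowP; case.
have mH m (e : 'rV[R]_m) (s : R) : measurable [set x | dotv e x = s].
  rewrite -[X in measurable X]setTI; exact: (measurable_dotv e _ (measurable_set1 s)).
have [c'0|c'0] := eqVneq (rsubmx (c : 'rV_(1 + n))) 0; last first.
  rewrite /= /lebesgue_step /pushforward /= /product_measure1.
  rewrite integral0_eq// => t _ /=.
  rewrite (_ : xsection _ _ =
    [set y | dotv (rsubmx (c : 'rV_(1 + n))) y = r - c 0 ord0 * t]).
    exact: IHn.
  apply/seteqP; split => y /=.
    by rewrite /xsection /= inE /= /cons_rV /= dotv_row_mx => <-; rewrite addrC addKr.
  by rewrite /xsection /= inE /= /cons_rV /= dotv_row_mx => ->; rewrite addrC subrK.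
have c00 : c 0 ord0 != 0.
  apply: contra c0 => /eqP c00; apply/eqP/rowP => i.
  have [j|j] := split_ordP (i : 'I_(1 + n)) => ->.
    by rewrite (ord1 j) mxE (_ : lshift n 0 = ord0)//; exact/val_inj.
  by move/rowP: c'0 => /(_ j); rewrite !mxE.
pose A (i : 'I_n.+1) : set (measurableTypeR R) :=
  if i == ord0 then [set r / c 0 ord0] else setT.
have mA i : measurable (A i) by rewrite /A; case: ifP.
have := lebesgue_rV_box mA.
rewrite big_ord_recl /A eqxx lebesgue_measure_set1 mul0e => H0.
apply: (subset_measure0 (mH _ _ _) (measurable_box mA) _ H0) => x /= xr i.
rewrite /A; case: eqP => //= ->.
have := xr; rewrite -[x in dotv c x](@hsubmxK _ 1 1 n) (_ : lsubmx _ = (x 0 0)%:M).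
  rewrite dotv_row_mx c'0 [dotv 0 _]big1 ?addr0; last by move=> ? _; rewrite mxE mul0r.
  by move=> <-; rewrite mulrC mulKf.
apply/matrixP => j k; rewrite !mxE (ord1 j) (ord1 k) eqxx mulr1n.
by congr (x _ _); exact/val_inj.
Qed.

Lemma lebesgue_measure_shift {R : realType} (t : R) (A : set (measurableTypeR R)) :
  measurable A ->
  pushforward lebesgue_measure
    ((fun x => t + x) : measurableTypeR R -> measurableTypeR R) A =
  lebesgue_measure A.
Proof.
move=> mA; have mt : measurable_fun setT
    ((fun x => t + x) : measurableTypeR R -> measurableTypeR R).
  exact: measurable_funD.
pose m := measure_function_pushforward__canonical__measure_function_Measure
  (@lebesgue_measure R) mt.
apply/esym/(@lebesgue_measure_unique R m) => // _ [[a b]] _ <-.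
rewrite /m/= /pushforward /=.
rewrite (_ : _ @^-1` _ = `](a - t)%R, (b - t)%R]%classic).
  rewrite !lebesgue_measure_itv/= !lte_fin ltrD2r.
  by case: ifP => // _; rewrite -!EFinB; congr EFin; ring.
by apply/seteqP; split => x /=; rewrite !in_itv/=; move=> /andP[? ?]; apply/andP; split; lra.
Qed.

Lemma measurable_shift {R : realType} n (t : 'rV[R]_n) :
  measurable_fun setT (fun x : 'rV[R]_n => t + x).
Proof.
apply: measurable_fun_rVP => i.
rewrite (_ : _ \o _ = (fun x : 'rV[R]_n => t 0 i + x 0 i)).
  by apply: measurable_funD => //; exact: measurable_coord.
by apply/funext => x; rewrite /= /coord_rV mxE.
Qed.

(** Fubini again: the first coordinate is shifted by the invariance of the
    measure of R, the other ones by induction. *)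
Lemma lebesgue_rV_shift {R : realType} n (t : 'rV[R]_n) (A : set 'rV[R]_n) :
  measurable A -> lebesgue_rV n ((fun x => t + x) @^-1` A) = lebesgue_rV n A.
Proof.
elim: n t A => [|n IHn] t A mA.
  rewrite /=; congr (dirac _ _); apply/seteqP; split => x /=;
  by rewrite [t + x]thinmx0 [x]thinmx0.
rewrite /= /lebesgue_step /pushforward /= /product_measure1.
set A' := cons_rV (n := n) @^-1` A.
have mA' : measurable A'.
  by rewrite -[A']setTI; exact: measurable_cons_rV.
set t0 := t 0 ord0; set t' := rsubmx (t : 'rV_(1 + n)).
pose phi (x : measurableTypeR R) := lebesgue_rV n (xsection A' x).
have mphi : measurable_fun setT phi by exact: measurable_fun_xsection.
have tE (x : R) (y : 'rV_n) :
    t + cons_rV (x : measurableTypeR R, y) = cons_rV (t0 + x, t' + y).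
  apply/rowP => i; rewrite mxE /cons_rV/=.
  have [j|j] := split_ordP (i : 'I_(1 + n)) => ->.
    rewrite !(@row_mxEl _ 1 1 n) !mxE (ord1 j) eqxx !mulr1n; congr (t _ _ + _).
    exact/val_inj.
  by rewrite !(@row_mxEr _ 1 1 n) !mxE.
transitivity (\int[lebesgue_measure]_x (phi (t0 + x)%R))%E.
  apply: eq_integral => x _; rewrite /phi /= -(IHn t' (xsection A' (t0 + x)%R)).
    congr (lebesgue_rV n _); apply/seteqP; split => y /=;
    by rewrite /xsection /= !inE /= /A' /= tE.
  exact: measurable_xsection.
transitivity (\int[pushforward lebesgue_measure
   ((fun x => t0 + x)%R : measurableTypeR R -> measurableTypeR R)]_x (phi x))%E.
  by rewrite ge0_integral_pushforward//; exact: measurable_funD.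
apply: eq_measure_integral => [|mt0 B mB _]; first exact: measurable_funD.
exact: lebesgue_measure_shift.
Qed.

Lemma Rintegral_shift {R : realType} n (t : 'rV[R]_n) (A : set 'rV[R]_n)
    (F : 'rV[R]_n -> R) :
  measurable A -> measurable_fun setT F ->
  (lebesgue_rV n).-integrable ((fun y => t + y) @^-1` A)
    (EFin \o (fun y => F (t + y))) ->
  \int[lebesgue_rV n]_(y in (fun y => t + y) @^-1` A) F (t + y) =
  \int[lebesgue_rV n]_(x in A) F x.
Proof.
move=> mA mF iF; rewrite /Rintegral; congr fine.
rewrite -(@integral_pushforward _ _ _ _ _ _ (measurable_shift t) _ _ (EFin \o F))//.
  apply: eq_measure_integral => [|mt B mB _]; first exact: measurable_shift.
  by rewrite /= /pushforward lebesgue_rV_shift.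
exact/measurable_EFinP.
Qed.

Section borel.
Context {R : realType} {n : nat}.

(** An open set is the union of the cubes with rational center and side that
    it contains, and these are countably many. *)
Lemma open_measurable_rV (U : set 'rV[R]_n) : open U -> measurable U.
Proof.
move=> oU.
pose B (p : 'rV[rat]_n * nat) : set 'rV[R]_n :=
  [set y | forall i, `]ratr (p.1 0 i) - p.2.+1%:R^-1,
    ratr (p.1 0 i) + p.2.+1%:R^-1[%classic (y 0 i)].
rewrite (_ : U = \bigcup_p (if `[< B p `<=` U >] then B p else set0)).
  apply: countable_bigcupT_measurable => [|p]; first exact: countableP.
  case: ifP => // _.
  exact: (@measurable_box _ _ (fun i => `]ratr (p.1 0 i) - p.2.+1%:R^-1,
    ratr (p.1 0 i) + p.2.+1%:R^-1[%classic)).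
apply/seteqP; split => [x Ux|x [p _]]; last by case: asboolP => // + ?; exact.
have : nbhs x U by exact: open_nbhs_nbhs.
move=> /nbhs_ballP[e /= e0 xeU].
have [k ke] : exists k, k.+1%:R^-1 < e / 2.
  have /ltr_add_invr[k] : 0 < e / 2 by rewrite divr_gt0.
  by rewrite add0r => ke; exists k.
have /= q_ (i : 'I_n) : {q : rat | x 0 i - k.+1%:R^-1 < ratr q < x 0 i + k.+1%:R^-1}.
  apply: cid; have [|q] := @rat_in_itvoo R (x 0 i - k.+1%:R^-1) (x 0 i + k.+1%:R^-1).
    by rewrite ltrD2l gtrN// invr_gt0.
  by rewrite in_itv/=; exists q.
exists (\row_i sval (q_ i), k) => //; case: asboolP => [_|[]].
  move=> i; rewrite /= in_itv/= mxE.
  by case: (q_ i) => q /= /andP[qx xq]; rewrite ltrBlDr xq -ltrBlDr.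
  move=> y /= By; apply: xeU => /=; rewrite mx_norm_ball /ball_ /= /Num.Def.normr/=.
  rewrite mx_normrE; apply: bigmax_lt => // -[i j] _ /=.
  have := By j; rewrite /= mxE in_itv/= !mxE (ord1 i).
  case: (q_ j) => q /=; move: (ratr q : R) => r /andP[xr rx] /andP[ry yr].
  move: (k.+1%:R^-1 : R) ke xr rx ry yr => d ke xr rx ry yr.
  by rewrite ltr_norml; apply/andP; split; lra.
Qed.

Lemma continuous_measurable_rV (A : set 'rV[R]_n) (f : 'rV[R]_n -> R) :
  measurable A -> {within A, continuous f} -> measurable_fun A f.
Proof.
move=> mA /continuousP cf; apply: (measurability _ (RGenOpens.measurableE R)).
move=> _ [_ [a [b ->] <-]].
have /open_subspaceP[V oV VA] := cf _ (interval_open (a := BRight a)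
  (b := BLeft b) isT isT).
by rewrite setIC -VA; apply: measurableI => //; exact: open_measurable_rV.
Qed.

End borel.

(** * Scalar product and l1 norm *)

Section dotv.
Context {R : realType} {n : nat}.
Implicit Types (c p w x y : 'rV[R]_n).

Lemma dotvC x y : dotv x y = dotv y x.
Proof. by apply: eq_bigr => i _; rewrite mulrC. Qed.

Lemma dotvDr c x y : dotv c (x + y) = dotv c x + dotv c y.
Proof.
by rewrite /dotv -big_split/=; apply: eq_bigr => i _; rewrite mxE mulrDr.
Qed.

Lemma dotvNr c x : dotv c (- x) = - dotv c x.
Proof. by rewrite /dotv -sumrN; apply: eq_bigr => i _; rewrite mxE mulrN. Qed.

Lemma dotvZr c (t : R) x : dotv c (t *: x) = t * dotv c x.
Proof.
by rewrite /dotv mulr_sumr; apply: eq_bigr => i _; rewrite mxE mulrCA.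
Qed.

Lemma dotvBr c x y : dotv c (x - y) = dotv c x - dotv c y.
Proof. by rewrite dotvDr dotvNr. Qed.

Lemma dotvBl c p x : dotv (c - p) x = dotv c x - dotv p x.
Proof. by rewrite dotvC dotvBr !(dotvC x). Qed.

Lemma dotv_delta c i : dotv c (delta_mx 0 i) = c 0 i.
Proof.
rewrite /dotv (bigD1 i)//= mxE !eqxx mulr1 big1 ?addr0// => j ji.
by rewrite mxE (negbTE ji) andbF mulr0.
Qed.

Definition l1norm c : R := \sum_(i < n) `|c 0 i|.

Lemma l1norm_ge0 c : 0 <= l1norm c.
Proof. exact: sumr_ge0. Qed.

Lemma dotv_le c w (d : R) : (forall i, `|w 0 i| <= d) ->
  `|dotv c w| <= l1norm c * d.
Proof.
move=> wd; rewrite mulr_suml (le_trans (ler_norm_sum _ _ _))//.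
by apply: ler_sum => i _; rewrite normrM ler_wpM2l.
Qed.

Lemma coord_le_l1norm c i : `|c 0 i| <= l1norm c.
Proof. by rewrite /l1norm (bigD1 i)//= lerDl sumr_ge0. Qed.

Lemma l1norm_continuous : continuous l1norm.
Proof.
apply: continuous_big; first exact: add_continuous.
move=> i _ x; apply: continuous_comp; first exact: coord_continuous.
exact: norm_continuous.
Qed.

Lemma dotv_continuous c : continuous (dotv c).
Proof.
apply: continuous_big; first exact: add_continuous.
move=> i _ x; apply: (@continuousM _ _ (fun=> c 0 i) (fun y => y 0 i)).
  exact: cst_continuous.
exact: coord_continuous.
Qed.

Lemma compact_bound (A : set 'rV[R]_n) (g : 'rV[R]_n -> R) : compact A ->
  {within A, continuous g} ->
  exists2 K, 0 <= K & forall x, A x -> `|g x| <= K.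
Proof.
move=> cA cg; have [->|/set0P A0] := eqVneq A set0; first by exists 0.
have [c _ cmax] := EVT_max_rV A0 cA cg.
have [d _ dmin] := EVT_min_rV A0 cA cg.
exists (`|g c| + `|g d|) => [|x /mem_set Ax]; first exact: addr_ge0.
have := cmax _ Ax; have := dmin _ Ax; rewrite ler_norml.
have := ler_norm (g c); have := ler_norm (- g d); rewrite normrN.
have := normr_ge0 (g c); have := normr_ge0 (g d).
by move=> *; apply/andP; split; lra.
Qed.

Lemma l1norm_bounded (Q : set 'rV[R]_n) (F : 'rV[R]_n -> 'rV[R]_n) :
  compact Q -> continuous F ->
  exists2 M, 0 <= M & forall q, Q q -> l1norm (F q) <= M.
Proof.
move=> cQ cF.
have cl : continuous (l1norm \o F).
  by move=> x; apply: continuous_comp; [exact: cF|exact: l1norm_continuous].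
have [K K0 FK] := compact_bound cQ (continuous_subspaceT cl).
by exists K => // q /FK; apply: le_trans; exact: ler_norm.
Qed.

End dotv.

(** * Gradients and subgradients *)

Section gradient.
Context {R : realType} {n : nat}.
Implicit Types (f : 'rV[R]_n -> R) (x y w : 'rV[R]_n).

Lemma derive_grad f x w : differentiable f x -> 'D_w f x = dotv (grad f x) w.
Proof.
move=> df; rewrite deriveE// {1}(row_sum_delta w) linear_sum /dotv.
by apply: eq_bigr => i _; rewrite linearZ/= mxE -deriveE// mulrC.
Qed.

(** The slope of [f] from [x] towards [y] decreases to the directional
    derivative.  Convexity is only asked for on the segment from [x] to [y], so
    that the lemma serves functions that are convex on Theta as well as globally
    convex ones, also at boundary points. *)
Lemma subgradient_grad f x y : differentiable f x ->
  (forall t : R, 0 < t < 1 ->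
     f (t *: y + (1 - t) *: x) <= t * f y + (1 - t) * f x) ->
  dotv (grad f x) (y - x) <= f y - f x.
Proof.
move=> df fcvx; rewrite -derive_grad//.
have := cvg_dnbhs_at_right (@diff_derivable _ _ _ f x (y - x) df).
move=> /cvgr_to_le; apply; near=> t.
have t0 : 0 < t by near: t; exact: nbhs_right_gt.
have t1 : t < 1 by near: t; exact: nbhs_right_lt.
rewrite /= /GRing.scale/= ler_pdivrMl//.
rewrite (_ : t *: (y - x) + x = t *: y + (1 - t) *: x).
  by have := fcvx t; rewrite t0 t1 => /(_ isT); lra.
by rewrite scalerBr scalerBl scale1r addrAC addrA.
Unshelve. all: by end_near. Qed.

Lemma gradB_cst f (m : R) : grad (fun x => f x - m) = grad f.
Proof.
apply/funext => x; apply/rowP => i; rewrite !mxE /derive.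
set F := (X in lim (fmap X _) = _); set F' := (X in _ = lim (fmap X _)).
suff -> : F = F' by [].
by apply/funext => h; rewrite /F /F' /= opprD opprK addrACA addNr addr0.
Qed.

End gradient.

Section grad_measurable.
Context {R : realType} {n : nat}.
Variables (a b : R).

(** A partial derivative at an interior point of Theta is a limit of difference
    quotients with steps [1 / (k + 1)].  To make these measurable, [f] is replaced
    by its extension by 0 outside Theta, which has the same quotients at small
    steps. *)
Lemma measurable_grad (f : 'rV[R]_n -> R) (G : set 'rV[R]_n) (i : 'I_n) :
  measurable (Theta a b : set 'rV[R]_n) ->
  {within Theta a b, continuous f} -> measurable G ->
  (forall x, G x -> (forall i, a < x 0 i < b) /\ differentiable f x) ->
  measurable_fun G (fun x => grad f x 0 i).
Proof.
move=> mT cf mG hG.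
pose e : 'rV[R]_n := delta_mx 0 i.
pose F := f \_ (Theta a b).
have mF : measurable_fun setT F.
  by apply/(measurable_restrictT _ mT); exact: continuous_measurable_rV.
apply: (@measurable_fun_cvg _ _ _ _
  (fun k x => k.+1%:R * (F (k.+1%:R^-1 *: e + x) - F x))) => [k|x Gx].
  apply: measurable_funTS; apply: measurable_funM => //.
  apply: measurable_funB => //; apply: measurableT_comp => //.
  exact: measurable_shift.
have [xab dfx] := hG _ Gx.
rewrite mxE.
have /cvgr_dnbhsP/(_ harmonic) := @diff_derivable _ _ _ f x e dfx.
(* Once [1 / (k + 1) < b - x_i], the shifted point is still in Theta. *)
have hcvg : harmonic @ \oo --> (0 : R) by exact: cvg_harmonic.
move=> /(_ (conj (fun k => _) hcvg)); have hn0 k : (harmonic k : R) != 0.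
  by rewrite gt_eqF// harmonic_gt0.
move=> /(_ hn0); apply: cvg_trans; apply: near_eq_cvg; near=> k.
have Tx : Theta a b x by move=> j; have /andP[/ltW-> /ltW->] := xab j.
rewrite /= /GRing.scale/= invrK /F !patchE !mem_set//.
have kb : k.+1%:R^-1 < b - x 0 i.
  near: k; apply: (cvgr_lt _ hcvg).
  by rewrite subr_gt0; have /andP[] := xab i.
move=> j; rewrite !mxE /=; have /andP[xa xb] := xab j.
case: eqP => [->|_]; rewrite ?andbT ?andbF ?mulr0 ?add0r ?(ltW xa) ?(ltW xb)//.
rewrite mulr1n mulr1 -lerBrDr (ltW kb) andbT.
by have /andP[/ltW ax _] := xab i; rewrite (le_trans ax)// lerDr invr_ge0.
Unshelve. all: by end_near. Qed.

End grad_measurable.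

Lemma near_eq_differentiable {K : numFieldType} {V W : normedModType K}
    (f g : V -> W) (x : V) : {near x, f =1 g} ->
  differentiable f x -> differentiable g x.
Proof.
move=> fg df.
have gx : g \o shift x = cst (g x) + 'd f x +o_ 0 id.
  apply/eqaddoP => _/posnumP[e].
  have /eqaddoP/(_ e%:num) := diff_locally df.
  move=> /(_ [gt0 of e%:num]); apply: filter_app.
  have := fg; rewrite (near_shift 0 x)/= subr0 => fg0; near=> h.
  have -> : (g \o shift x - (cst (g x) + 'd f x)) h =
            (f \o shift x - (cst (f x) + 'd f x)) h.
    rewrite -![(_ - _ : _ -> _) _]/(_ - _) /= /cst.
    rewrite -![(_ + _ : _ -> _) _]/(_ + _) (nbhs_singleton fg).
    suff -> : f (h + x) = g (h + x) by [].
    by have := near fg0 h; exact.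
  by [].
have dfc : continuous ('d f x) by exact: diff_continuous.
by apply/diff_locallyP; rewrite (diff_unique dfc gx).
Unshelve. all: by end_near. Qed.

Section differentiability.
Context {R : realType} {n : nat}.
Implicit Types (f g : 'rV[R]_n -> R) (c x : 'rV[R]_n).

Lemma near_eq_grad f g x : {near x, f =1 g} -> grad f x = grad g x.
Proof. by move=> fg; apply/rowP => i; rewrite !mxE; exact: near_eq_derive. Qed.

Lemma differentiable_dotv c x : differentiable (dotv c) x.
Proof.
rewrite (_ : dotv c = \sum_(i < n) (c 0 i *: (fun y : 'rV[R]_n => y 0 i : R))).
  by apply: differentiable_sum => i; apply: differentiableZ; exact: differentiable_coord.
by apply/funext => y; rewrite fct_sumE.
Qed.

Lemma grad_dotv c x : grad (dotv c) x = c.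
Proof.
apply/rowP => i; rewrite mxE /derive -[RHS]dotv_delta.
apply: lim_near_cst => //; near=> h.
have h0 : h != 0 by near: h; exact: nbhs_dnbhs_neq.
by rewrite /= dotvDr dotvZr addrK /GRing.scale/= mulKf.
Unshelve. all: by end_near. Qed.

End differentiability.

(** * Maxima of affine functions *)

Section max_affine_theory.
Context {R : realType} {n : nat}.
Variables (a b : R) (k : nat).
Variables (v : grid (n := n) k.+1 -> R) (D : grid (n := n) k.+1 -> 'rV[R]_n).
Implicit Types (i j : grid (n := n) k.+1) (x y : 'rV[R]_n).

Local Notation piece := (affine_piece a b v D).
Local Notation f := (max_affine a b v D).

Lemma affine_pieceE i x y : piece i y = piece i x + dotv (D i) (y - x).
Proof.
rewrite /affine_piece -addrA -dotvDr; congr (_ + dotv _ _).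
by rewrite [RHS]addrC addrA subrK.
Qed.

Lemma affine_piece_center i : piece i (Defs.center a b i) = v i.
Proof. by rewrite /affine_piece subrr -(scale0r 0) dotvZr mul0r addr0. Qed.

Lemma le_max_affine i x : piece i x <= f x.
Proof. exact: (le_bigmax _ (piece^~ x) i). Qed.

Lemma max_affine_eq x : exists i, f x = piece i x.
Proof.
rewrite /max_affine; apply: (big_ind (fun t => exists i, t = piece i x)).
- by eexists.
- move=> _ _ [i ->] [j ->]; rewrite /Num.max.
  by case: ifP => _; [exists j|exists i].
- by move=> i _; exists i.
Qed.

(** The slope of a piece that attains the maximum is a subgradient: [f] lies above
    that piece and touches it at [x]. *)
Lemma max_affine_subgradient i x y : f x = piece i x ->
  dotv (D i) (y - x) <= f y - f x.
Proof.
by move=> fx; rewrite lerBrDl {1}fx -affine_pieceE le_max_affine.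
Qed.

(** The discrete convexity constraint says that at the center of a cube no piece
    exceeds the piece of this cube. *)
Lemma max_affine_center i :
  (forall i j, v i - v j + dotv (D i) (Defs.center a b j - Defs.center a b i) <= 0) ->
  f (Defs.center a b i) = v i.
Proof.
move=> vD; apply/eqP; rewrite eq_le; apply/andP; split.
  have [j ->] := max_affine_eq (Defs.center a b i).
  by have := vD j i; rewrite /affine_piece; lra.
by apply: le_trans (le_max_affine i _); rewrite affine_piece_center.
Qed.

Lemma max_affine_convex x y (t : R) : 0 <= t <= 1 ->
  f (t *: x + (1 - t) *: y) <= t * f x + (1 - t) * f y.
Proof.
move=> /andP[t0 t1]; have [i ->] := max_affine_eq (t *: x + (1 - t) *: y).
rewrite (_ : piece i _ = t * piece i x + (1 - t) * piece i y).
  by rewrite lerD// ler_wpM2l ?le_max_affine// subr_ge0.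
by rewrite /affine_piece !dotvBr dotvDr !dotvZr; ring.
Qed.

Section Lipschitz.
Variable (M : R).
Hypothesis DM : forall i, l1norm (D i) <= M.

Lemma max_affine_Lipschitz x y (d : R) : 0 <= d ->
  (forall l, `|x 0 l - y 0 l| <= d) -> `|f x - f y| <= M * d.
Proof.
move=> d0 xyd; wlog suff H : x y xyd / f x - f y <= M * d.
  rewrite ler_norml lerNl opprB !H// => l.
  by rewrite distrC.
have [i fx] := max_affine_eq x.
apply: (@le_trans _ _ (dotv (D i) (x - y))).
  by rewrite lerBlDr fx (affine_pieceE i y) addrC lerD2l le_max_affine.
rewrite (le_trans (ler_norm _))//.
apply: le_trans (@dotv_le _ _ _ _ d _) _.
  by move=> l; rewrite !mxE.
by rewrite ler_wpM2r.
Qed.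

End Lipschitz.

Lemma affine_piece_continuous i : continuous (piece i).
Proof.
rewrite (_ : piece i = cst (v i - dotv (D i) (Defs.center a b i)) + dotv (D i)).
  by move=> x; apply: continuousD; [exact: cst_continuous|exact: dotv_continuous].
by apply/funext => x; rewrite /affine_piece dotvBr addrAC addrA.
Qed.

Lemma max_affine_continuous : continuous f.
Proof.
rewrite /max_affine; elim: (index_enum _) => [|i r IHr].
  rewrite (_ : (fun=> _) = piece [ffun=> ord0]); first exact: affine_piece_continuous.
  by apply/funext => x; rewrite big_nil.
move=> x; rewrite (_ : (fun=> _) = piece i \max
    (fun y => \big[Num.max/piece [ffun=> ord0] y]_(j <- r) piece j y)).
  by apply: continuous_max; [exact: affine_piece_continuous|exact: IHr].
by apply/funext => y; rewrite big_cons.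
Qed.

(** If the pieces that attain the maximum at [x] have the same slope, they
    coincide; the other ones are strictly below at [x], hence near [x], so that
    [f] is affine near [x]. *)
Lemma max_affine_differentiable x :
  (forall i j, D i != D j -> piece i x != piece j x) ->
  exists i, [/\ f x = piece i x, differentiable f x & grad f x = D i].
Proof.
move=> sep; have [i fx] := max_affine_eq x; exists i.
have ffx : {near x, piece i =1 f}.
  have le_near j : \forall y \near x, piece j y <= piece i y.
    have [Dij|Dij] := eqVneq (D i) (D j).
      near=> y; rewrite (affine_pieceE i x) (affine_pieceE j x) Dij lerD2r -fx.
      exact: le_max_affine.
    have : piece j x < piece i x.
      by rewrite lt_neqAle eq_sym sep// -fx le_max_affine.
    rewrite -subr_gt0 => ji.
    have c : {for x, continuous (piece i - piece j)}.
      by apply: continuousB; exact: affine_piece_continuous.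
    near=> y; rewrite ltW// -subr_gt0.
    by near: y; exact: (cvgr_gt _ c _ ji).
  near=> y; have yle : forall j, piece j y <= piece i y.
    by near: y; exact: filter_forall le_near.
  apply/eqP; rewrite eq_le le_max_affine/=.
  by have [j ->] := max_affine_eq y.
have pE : piece i = (fun y => dotv (D i) y - (dotv (D i) (Defs.center a b i) - v i)).
  by apply/funext => y; rewrite /affine_piece dotvBr; ring.
have dp : differentiable (piece i) x.
  rewrite pE; apply: (@differentiableB _ _ _ (dotv (D i)) (cst _)) => //.
  exact: differentiable_dotv.
split => //; first exact: near_eq_differentiable ffx dp.
by rewrite -(near_eq_grad ffx) pE gradB_cst grad_dotv.
Unshelve. all: by end_near. Qed.

(** Two pieces with different slopes agree on a hyperplane only, and these
    finitely many hyperplanes are null. *)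
Lemma max_affine_ae :
  {ae lebesgue_rV n, forall x, exists i,
    [/\ f x = piece i x, differentiable f x & grad f x = D i]}.
Proof.
have : {ae lebesgue_rV n, forall x, forall p : grid (n := n) k.+1 * grid (n := n) k.+1,
    D p.1 != D p.2 -> piece p.1 x != piece p.2 x}.
  apply: (@filter_forall _ _ (fun (p : grid (n := n) k.+1 * grid (n := n) k.+1)
    x => is_true (D p.1 != D p.2) -> is_true (piece p.1 x != piece p.2 x))).
  move=> [i j] /=; have [Dij|Dij] := eqVneq (D i) (D j).
    exact: aeW.
  have Dn : D i - D j != 0 by rewrite subr_eq0.
  set r := dotv (D i) (Defs.center a b i) - v i - (dotv (D j) (Defs.center a b j) - v j).
  exists [set x | dotv (D i - D j) x = r]; split.
  - rewrite -[X in measurable X]setTI.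
    exact: (measurable_dotv _ _ (measurable_set1 r)).
  - exact: hyperplane_null.
  - move=> x /=; apply: contra_notP => xr _; apply/eqP => pij; apply: xr.
    rewrite dotvBl /r; move: pij; rewrite /affine_piece !dotvBr; lra.
apply: filterS => x sep; apply: max_affine_differentiable => i j.
exact: (sep (i, j)).
Qed.

Lemma max_affine_grad_ae (Q : set 'rV[R]_n) : (forall i, Q (D i)) ->
  {ae lebesgue_rV n, forall x, Theta a b x -> differentiable f x /\ Q (grad f x)}.
Proof. by move=> DQ; apply: filterS max_affine_ae => x [i [_ df ->]] _. Qed.

End max_affine_theory.

(** * The partition into cubes *)

Section cells.
Context {R : realType} {n : nat}.
Variables (a b : R).
Hypothesis ab : a < b.
Implicit Types (x y : 'rV[R]_n).

Lemma ThetaE : Theta a b = [set x : 'rV[R]_n | forall i,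
  (fun=> `[a, b]%classic) i (x 0 i)].
Proof.
by apply/seteqP; split => x /= xab i; have := xab i; rewrite in_itv.
Qed.

Lemma measurable_Theta : measurable (Theta a b : set 'rV[R]_n).
Proof.
rewrite ThetaE; apply: (@measurable_box R n (fun=> `[a, b]%classic)) => i.
exact: measurable_itv.
Qed.

Lemma compact_Theta : compact (Theta a b : set 'rV[R]_n).
Proof.
rewrite ThetaE; apply: (@rV_compact _ n (fun=> `[a, b]%classic)) => i.
exact: segment_compact.
Qed.

Lemma lebesgue_Theta :
  lebesgue_rV n (Theta a b : set 'rV[R]_n) = ((b - a) ^+ n)%:E.
Proof.
rewrite ThetaE (@lebesgue_rV_box R n (fun=> `[a, b]%classic)) => [|i].
  rewrite (eq_bigr (fun=> (b - a)%:E)) => [|l _].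
    by rewrite prodEFin prodr_const card_ord.
  by rewrite lebesgue_measure_itv/= lte_fin ab -EFinB.
exact: measurable_itv.
Qed.

Lemma Theta_bound x : Theta a b x -> forall l, `|x 0 l| <= `|a| + `|b|.
Proof.
move=> Tx l; have /andP[al lb] := Tx l.
have := ler_norm b; have := ler_norm (- a); rewrite normrN ler_norml.
have := normr_ge0 a; have := normr_ge0 b.
by move=> *; apply/andP; split; lra.
Qed.

Section one_grid.
Variable k : nat.
Implicit Types (i j : grid (n := n) k.+1).

Let h : R := (b - a) / k.+1%:R.

(** Half-open cubes, so that they are pairwise disjoint and translates of each
    other; they miss the upper faces of Theta, which are null. *)
Definition cell i : set 'rV[R]_n :=
  [set x | forall l, a + (i l)%:R * h <= x 0 l < a + (i l).+1%:R * h].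

Definition base_cell : set 'rV[R]_n :=
  [set y | forall l, - (h / 2) <= y 0 l < h / 2].

Let h0 : 0 < h. Proof. by rewrite divr_gt0// subr_gt0. Qed.

Let hk : k.+1%:R * h = b - a. Proof. by rewrite mulrC divfK. Qed.

Lemma cell_center i x : cell i x ->
  forall l, `|x 0 l - Defs.center a b i 0 l| <= h / 2.
Proof.
move=> ix l; have := ix l; rewrite mxE -/h -[(i l).+1%:R]natr1 => /andP[? ?].
by rewrite ler_norml; apply/andP; split; lra.
Qed.

Lemma cell_sub i : cell i `<=` Theta a b.
Proof.
move=> x ix l; have /andP[il li] := ix l; apply/andP; split.
  by rewrite (le_trans _ il)// lerDl mulr_ge0// ltW.
rewrite (le_trans (ltW li))// -lerBrDl -hk ler_pM2r// ler_nat.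
exact: ltn_ord.
Qed.

Lemma cell_inj i j x : cell i x -> cell j x -> i = j.
Proof.
move=> ix jx; apply/ffunP => l; apply/val_inj/eqP; rewrite eqn_leq.
have le (i' j' : grid (n := n) k.+1) : cell i' x -> cell j' x -> (i' l <= j' l)%N.
  move=> /(_ l)/andP[ix1 _] /(_ l)/andP[_ jx2].
  have := le_lt_trans ix1 jx2.
  by rewrite ltrD2l ltr_pM2r// ltr_nat ltnS.
by rewrite !le.
Qed.

Lemma cell_cover x : (forall l, a <= x 0 l < b) -> exists i, cell i x.
Proof.
move=> xab; pose t l := (x 0 l - a) / h.
have t0 l : 0 <= t l.
  by rewrite divr_ge0 ?(ltW h0)// subr_ge0; have /andP[] := xab l.
have tk l : (Num.truncn (t l) < k.+1)%N.
  rewrite -(ltr_nat R); apply: (@le_lt_trans _ _ (t l)).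
    by have /andP[] := truncn_itv (t0 l).
  by rewrite ltr_pdivrMr// hk ltrD2r; have /andP[] := xab l.
exists [ffun l => Ordinal (tk l)] => l; rewrite ffunE /=.
have /andP[] := truncn_itv (t0 l).
by rewrite ler_pdivlMr// ltr_pdivrMr// lerBrDl ltrBlDl => -> ->.
Qed.

Lemma shift_cell i : (fun y => Defs.center a b i + y) @^-1` cell i = base_cell.
Proof.
apply/seteqP; split => y /= iy l; have := iy l; rewrite !mxE -/h -[(i l).+1%:R]natr1;
  by move=> /andP[? ?]; apply/andP; split; lra.
Qed.

Lemma measurable_cell i : measurable (cell i).
Proof.
rewrite (_ : cell i = [set x | forall l,
  (fun l => `[a + (i l)%:R * h, a + (i l).+1%:R * h[%classic) l (x 0 l)]).
  by apply: (@measurable_box R n (fun l => `[a + (i l)%:R * h,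
    a + (i l).+1%:R * h[%classic)) => l; exact: measurable_itv.
by apply/seteqP; split => x /= xab l; have := xab l; rewrite in_itv.
Qed.

Lemma lebesgue_cell i : lebesgue_rV n (cell i) = (cube_volume (n := n) a b k.+1)%:E.
Proof.
rewrite (_ : cell i = [set x | forall l,
  (fun l => `[a + (i l)%:R * h, a + (i l).+1%:R * h[%classic :
     set (measurableTypeR R)) l (x 0 l)]); last first.
  by apply/seteqP; split => x /= xab l; have := xab l; rewrite in_itv.
rewrite (@lebesgue_rV_box R n (fun l => `[a + (i l)%:R * h,
  a + (i l).+1%:R * h[%classic)); last by move=> l; exact: measurable_itv.
rewrite (eq_bigr (fun=> h%:E)) => [|l _]; last first.
  rewrite lebesgue_measure_itv/= lte_fin ltrD2l ltr_pM2r// ltr_nat ltnSn.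
  by rewrite -EFinB -natr1; congr EFin; ring.
by rewrite prodEFin prodr_const card_ord.
Qed.

Lemma measurable_base_cell : measurable base_cell.
Proof.
rewrite -(shift_cell [ffun=> ord0]) -[X in measurable X]setTI.
by apply: measurable_shift => //; exact: measurable_cell.
Qed.

Lemma lebesgue_base_cell :
  lebesgue_rV n base_cell = (cube_volume (n := n) a b k.+1)%:E.
Proof.
rewrite -(shift_cell [ffun=> ord0]) lebesgue_rV_shift ?lebesgue_cell//.
exact: measurable_cell.
Qed.

Lemma trivIset_cell : trivIset setT cell.
Proof. by move=> i j _ _ [x [ix jx]]; exact: cell_inj ix jx. Qed.

Lemma cube_volume_gt0 : 0 < cube_volume (n := n) a b k.+1.
Proof. exact: exprn_gt0. Qed.

Lemma cube_volume_sum : cube_volume (n := n) a b k.+1 * #|grid (n := n) k.+1|%:R =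
  (b - a) ^+ n.
Proof.
by rewrite card_ffun !card_ord natrX -exprMn mulrC hk.
Qed.

Lemma integrable_cell (F : 'rV[R]_n -> R) (K : R) : measurable_fun setT F ->
  (forall x, `|F x| <= K) ->
  forall i, (lebesgue_rV n).-integrable (cell i) (EFin \o F).
Proof.
move=> mF FK i; apply: (bounded_integrable (measurable_cell i)
  (lebesgue_cell i) _ (fun x _ => FK x)).
exact: measurable_funTS.
Qed.

Lemma Rintegral_cells (F : 'rV[R]_n -> R) (K : R) : measurable_fun setT F ->
  (forall x, `|F x| <= K) ->
  \int[lebesgue_rV n]_(x in \big[setU/set0]_(i : grid (n := n) k.+1) cell i) F x =
  \sum_(i : grid (n := n) k.+1) \int[lebesgue_rV n]_(x in cell i) F x.
Proof.
move=> mF FK; rewrite /Rintegral integral_bigsetU_EFin//.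
- rewrite -sum_fine// => i _; apply: integrable_fin_num.
    exact: measurable_cell.
  exact: integrable_cell FK _.
- exact: measurable_cell.
- exact: index_enum_uniq.
- by apply: sub_trivIset trivIset_cell.
- by apply/measurable_EFinP; exact: measurable_funTS.
Qed.

End one_grid.

(** * The functional as a sum of integrals over the cubes *)

Lemma face_ae : {ae lebesgue_rV n, forall x l, x 0 l != a /\ x 0 l != b}.
Proof.
have hyp (r : R) : {ae lebesgue_rV n, forall x l, x 0 l != r}.
  apply: (@filter_forall _ _ (fun l x => is_true (x 0 l != r))) => l.
  have e0 : (delta_mx 0 l : 'rV[R]_n) != 0.
    apply/eqP => /rowP/(_ l)/eqP; rewrite !mxE !eqxx /=.
    by rewrite oner_eq0.
  exists [set x | dotv (delta_mx 0 l) x = r]; split.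
  - rewrite -[X in measurable X]setTI.
    exact: (measurable_dotv _ _ (measurable_set1 r)).
  - exact: hyperplane_null.
  - by move=> x /= /negP; rewrite negbK => /eqP <-; rewrite dotvC dotv_delta.
by apply: filterS2 (hyp a) (hyp b) => x xa xb l; split.
Qed.

Lemma null_cell (G : set 'rV[R]_n) k (i : grid (n := n) k.+1) : measurable G ->
  lebesgue_rV n (Theta a b `\` G) = 0%E -> lebesgue_rV n (cell i `\` G) = 0%E.
Proof.
move=> mG; apply: subset_measure0.
- by apply: measurableD => //; exact: measurable_cell.
- by apply: measurableD => //; exact: measurable_Theta.
- by move=> x [/cell_sub ? ?]; split.
Qed.

Section representation.
Variables (Q : set 'rV[R]_n) (C : 'rV[R]_n -> R) (f : 'rV[R]_n -> R).
Hypothesis Q_compact : compact Q.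
Hypothesis C_cont : continuous C.
Hypothesis f_cont : {within Theta a b, continuous f}.
Hypothesis f_grad : {ae lebesgue_rV n,
  forall x, Theta a b x -> differentiable f x /\ Q (grad f x)}.

(** The integrand of the functional is replaced by a bounded function [F] that is
    measurable on the whole space: [F] is the Lagrangian on a measurable set [G]
    of interior points of differentiability, and 0 elsewhere.  Every later
    computation is done with [F] over the cubes. *)
Lemma lagrangian_representation :
  exists (G : set 'rV[R]_n) (F : 'rV[R]_n -> R) (K : R),
  [/\ measurable G /\ (forall x, G x ->
        [/\ Theta a b x, differentiable f x & Q (grad f x)]),
      lebesgue_rV n (Theta a b `\` G) = 0%E,
      measurable_fun setT F /\ (forall x, `|F x| <= K),
      forall x, G x -> F x = lagrangian C x (f x) (grad f x) &
      forall k, functional a b C f =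
        \sum_(i : grid (n := n) k.+1) \int[lebesgue_rV n]_(x in cell i) F x].
Proof.
have [N [mN N0 Nsub]] : (lebesgue_rV n).-negligible (~` [set x |
    (Theta a b x -> differentiable f x /\ Q (grad f x)) /\
    forall l, x 0 l != a /\ x 0 l != b]).
  by apply: filterS2 f_grad face_ae => x.
have mT := measurable_Theta.
pose G := Theta a b `\` N.
have mG : measurable G by exact: measurableD.
have GN x : G x -> (Theta a b x -> differentiable f x /\ Q (grad f x)) /\
    forall l, x 0 l != a /\ x 0 l != b.
  by move=> [_]; apply: contra_notP => H; exact: Nsub.
have hG x : G x -> [/\ Theta a b x, differentiable f x & Q (grad f x)].
  by move=> Gx; have [/(_ Gx.1)[? ?] _] := GN _ Gx; split => //; case: Gx.
have GI x : G x -> (forall l, a < x 0 l < b) /\ differentiable f x.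
  move=> Gx; have [Tx df _] := hG _ Gx; split => // l.
  have [_ /(_ l)[xa xb]] := GN _ Gx.
  by have /andP[ax xb'] := Tx l; rewrite !lt_neqAle ax xb' eq_sym xa xb.
have null A : measurable A -> A `<=` Theta a b -> lebesgue_rV n (A `\` G) = 0%E.
  move=> mA AT; apply: (subset_measure0 _ mN _ N0); first exact: measurableD.
  by move=> x [Ax nGx]; apply: contrapT => Nx; apply: nGx; split => //; exact: AT.
pose L x := lagrangian C x (f x) (grad f x).
have mL : measurable_fun G L.
  have mg l : measurable_fun G (fun x => grad f x 0 l).
    exact: (measurable_grad l mT f_cont mG GI).
  have mf : measurable_fun G f.
    apply: measurable_funS (continuous_measurable_rV mT f_cont) => //.
    by move=> x [].
  rewrite /L /lagrangian; apply: measurable_funD.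
    apply: measurable_funB => //; apply: measurable_sum => l.
    by apply: measurable_funM => //; apply: measurable_funTS; exact: measurable_coord.
  pose g' := grad f \_ G.
  have mg' : measurable_fun setT g'.
    apply: measurable_fun_rVP => l.
    have mgl : measurable_fun setT ((fun x => grad f x 0 l : R) \_ G).
      by apply/(measurable_restrictT _ mG); exact: mg.
    suff -> : coord_rV l \o g' = (fun x => grad f x 0 l : R) \_ G by exact: mgl.
    apply/funext => x; rewrite /g' /= /coord_rV !patchE; case: ifP => // _.
    by rewrite mxE.
  have mC : measurable_fun setT C.
    by apply: continuous_measurable_rV => //; exact: continuous_subspaceT.
  apply: (eq_measurable_fun (C \o g')).
    by move=> x Gx; rewrite /g' /= patchE Gx.
  by apply: measurable_funTS; exact: measurableT_comp.
have [Kf Kf0 fK] := compact_bound compact_Theta f_cont.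
have [KC KC0 CK] := compact_bound Q_compact (continuous_subspaceT C_cont).
have [M M0 QM] := l1norm_bounded Q_compact (fun x => cvg_id).
have LK x : G x -> `|L x| <= Kf + M * (`|a| + `|b|) + KC.
  move=> Gx; have [Tx df Qx] := hG _ Gx.
  rewrite /L /lagrangian (le_trans (ler_normD _ _))//.
  rewrite lerD ?CK// (le_trans (ler_normB _ _))// lerD ?fK// dotvC.
  apply: (@le_trans _ _ (l1norm (grad f x) * (`|a| + `|b|))).
    by apply: dotv_le => l; exact: Theta_bound.
  by rewrite ler_wpM2r// ?QM// addr_ge0.
have mF : measurable_fun setT (L \_ G) by exact/(measurable_restrictT _ mG).
have FK x : `|(L \_ G) x| <= Kf + M * (`|a| + `|b|) + KC.
  rewrite patchE; case: ifPn => [/set_mem/LK//|_].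
  by rewrite normr0 !addr_ge0// mulr_ge0// addr_ge0.
exists G, (L \_ G), (Kf + M * (`|a| + `|b|) + KC); split.
- by split.
- exact: null.
- by split.
- by move=> x Gx; rewrite patchE mem_set.
- move=> k; rewrite -(Rintegral_cells _ mF FK).
  have GT : G `<=` Theta a b by move=> x [].
  have GU : G `<=` \big[setU/set0]_(i : grid (n := n) k.+1) cell i.
    move=> x Gx; have [xab _] := GI _ Gx.
    have [i ix] : exists i : grid (n := n) k.+1, cell i x.
      by apply: cell_cover => l; have /andP[/ltW -> ->] := xab l.
    by rewrite (bigD1 i)//=; left.
  have mU : measurable (\big[setU/set0]_(i : grid (n := n) k.+1) cell i).
    by apply: bigsetU_measurable => i _; exact: measurable_cell.
  have UT : \big[setU/set0]_(i : grid (n := n) k.+1) cell i `<=` Theta a b.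
    apply: (big_ind (fun A => A `<=` Theta a b)) => [//||i _].
      by move=> A B AT BT x [/AT|/BT].
    exact: cell_sub.
  rewrite (Rintegral_setD_null _ G) //; [|exact: null].
  rewrite /functional (Rintegral_setD_null _ G) //; [|exact: null].
  by apply: eq_Rintegral => x Gx; rewrite patchE Gx.
Qed.

End representation.
End cells.

(** * The discrete value is asymptotically at most the continuous one *)

Section sampling.
Context {R : realType} {n : nat}.
Variables (a b : R) (Q : set 'rV[R]_n) (C : 'rV[R]_n -> R).
Hypothesis ab : a < b.
Hypothesis Q_compact : compact Q.
Hypothesis C_cont : continuous C.

Lemma convex_functionP (A : set 'rV[R]_n) (f : 'rV[R]_n -> R) :
  convex_function A f -> forall x y (t : R), A x -> A y -> 0 < t < 1 ->
  f (t *: x + (1 - t) *: y) <= t * f x + (1 - t) * f y.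
Proof.
move=> cf x y t Ax Ay /andP[t0 t1].
have := cf (Itv01 (ltW t0) (ltW t1)) x y (mem_set Ax) (mem_set Ay).
by rewrite convRE.
Qed.

(** The competitor in the discrete program is the sample of [f] and of its
    gradient at the centers shifted by a common vector [y].  Any [y] outside a
    null set will do, and the average over [y] in [base_cell] of the resulting
    bounds is the integral of [F] over the cubes.  The error term is the price of
    evaluating the Lagrangian at [center i] instead of [center i + y]. *)
Lemma discrete_le_functional k (v : grid (n := n) k.+1 -> R)
  (D : grid (n := n) k.+1 -> 'rV[R]_n) (f : 'rV[R]_n -> R) (M : R) :
  discrete_solution a b Q C v D -> admissible a b Q f ->
  (forall q, Q q -> l1norm q <= M) ->
  discrete_functional a b C v D <=
  functional a b C f + M * ((b - a) / k.+1%:R / 2) * (b - a) ^+ n.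
Proof.
move=> [_ vDmin] [cf cvf f0 gf _] QM.
have [G [F [K [[mG GP] nT [mF FK] FE FI]]]] :=
  lagrangian_representation ab Q_compact C_cont cf gf.
have nG i : lebesgue_rV n (cell a b (i : grid (n := n) k.+1) `\` G) = 0%E.
  exact: null_cell.
set h := (b - a) / k.+1%:R; set vol := cube_volume (n := n) a b k.+1.
have h0 : 0 < h by rewrite divr_gt0// subr_gt0.
have vol0 : 0 < vol by exact: cube_volume_gt0.
pose c i := Defs.center a b (k := k.+1) (i : grid (n := n) k.+1).
have mB : measurable (base_cell a b k : set 'rV[R]_n).
  exact: measurable_base_cell.
have mc i := measurable_cell a b (i : grid (n := n) k.+1).
(* A single null set of bad shifts [y] has to serve all the cubes at once. *)
have [N [mN N0 Nsub]] : {ae lebesgue_rV n, forall y (i : grid (n := n) k.+1),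
    base_cell a b k y -> G (c i + y)}.
  apply: (@filter_forall _ _ (fun (i : grid (n := n) k.+1) y =>
    base_cell a b k y -> G (c i + y))) => i.
  exists ((fun y => c i + y) @^-1` (cell a b i `\` G)); split.
  - rewrite -[X in measurable X]setTI; apply: measurable_shift => //.
    by apply: measurableD.
  - by rewrite lebesgue_rV_shift ?nG//; exact: measurableD.
  - move=> y /= /not_implyP[By nGy]; split => //.
    by move: By; rewrite -(shift_cell a b i).
pose H := base_cell a b k `\` N.
have mH : measurable H by exact: measurableD.
have HB : H `<=` base_cell a b k by move=> x [].
have BH : lebesgue_rV n (base_cell a b k `\` H) = 0%E.
  apply: (subset_measure0 _ mN _ N0); first exact: measurableD.
  by move=> x [Bx nHx]; apply: contrapT => Nx; apply: nHx.
have HG y i : H y -> G (c i + y).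
  move=> [By nNy]; have /contrapT P := contra_not (@Nsub y) nNy.
  exact: P.
have muB : lebesgue_rV n (base_cell a b k) = vol%:E by exact: lebesgue_base_cell.
have muH : lebesgue_rV n H = vol%:E.
  by rewrite -muB; exact: measure_setD_null mB mH HB BH.
have sample y : H y -> discrete_functional a b C v D <=
    vol * \sum_(i : grid (n := n) k.+1) (F (c i + y) + M * (h / 2)).
  move=> Hy; apply: (@le_trans _ _ (discrete_functional a b C
      (fun i => f (c i + y)) (fun i => grad f (c i + y)))).
    apply: vDmin; split => [i|i|i j].
    - by apply: f0; have [] := GP _ (HG _ i Hy).
    - by have [] := GP _ (HG _ i Hy).
    - have [Ti di _] := GP _ (HG _ i Hy); have [Tj _ _] := GP _ (HG _ j Hy).
      have := subgradient_grad di (fun t => convex_functionP cvf Tj Ti (t := t)).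
      rewrite (_ : c j + y - (c i + y) = c j - c i); first by lra.
      by rewrite opprD addrACA subrr addr0.
  rewrite ler_pM2l//; apply: ler_sum => i _.
  have [Ti di Qi] := GP _ (HG _ i Hy).
  rewrite FE; last exact: HG.
  rewrite /lagrangian -/(c i).
  have : dotv y (grad f (c i + y)) <= M * (h / 2).
    rewrite dotvC (le_trans (ler_norm _))//.
    apply: (@le_trans _ _ (l1norm (grad f (c i + y)) * (h / 2))).
      apply: dotv_le => l; have /andP[? ?] := Hy.1 l.
      by rewrite ler_norml; apply/andP; split; [|exact: ltW].
    by rewrite ler_wpM2r ?QM// ltW// divr_gt0.
  by rewrite ![dotv (_ + y) _]dotvC dotvDr ![dotv (grad _ _) _]dotvC; lra.
have iFB i : (lebesgue_rV n).-integrable (base_cell a b k)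
    (EFin \o (fun y => F (c i + y))).
  apply: (bounded_integrable mB muB _ (fun y _ => FK (c i + y))).
  by apply: measurable_funTS; apply: measurableT_comp => //; exact: measurable_shift.
have cstH r : (lebesgue_rV n).-integrable H (EFin \o (fun=> r : R)).
  exact: (bounded_integrable mH muH _ (fun _ _ => lexx `|r|)).
have iH i : (lebesgue_rV n).-integrable H
    (EFin \o (fun y => F (c i + y) + M * (h / 2))).
  exact: (integrableD mH (integrableS mB mH HB (iFB i)) (cstH (M * (h / 2)))).
(* The pointwise bound [sample] is integrated over [H], whose measure is [vol]. *)
have [iS ES] := Rintegral_sum (index_enum _) mH iH.
have : \int[lebesgue_rV n]_(y in H) discrete_functional a b C v D <=
  \int[lebesgue_rV n]_(y in H)
     (vol * \sum_(i : grid (n := n) k.+1) (F (c i + y) + M * (h / 2))).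
  apply: le_Rintegral => //.
  by apply: (integrableZl mH vol iS).
rewrite Rintegral_cst// RintegralZl// ES [X in fine X]muH /= mulrC ler_pM2l//.
move=> /le_trans; apply.
under eq_bigr => i _.
  rewrite RintegralD//; last exact: integrableS mB mH HB (iFB i).
  rewrite Rintegral_cst// [X in fine X]muH /=.
  rewrite -(Rintegral_setD_null _ _ _ mB mH HB BH).
  have -> : base_cell a b k = (fun y => c i + y) @^-1` cell a b i.
    by rewrite shift_cell.
  rewrite Rintegral_shift//; last by rewrite shift_cell.
  over.
rewrite big_split/= -FI lerD2l sumr_const -(cube_volume_sum (n := n) a b k) -/vol.
by rewrite -mulr_natr; lra.
Qed.

End sampling.

(** * Second differences over the grid *)

Section grid_sums.
Context {R : realType} {n : nat}.
Variables (a b : R) (k : nat) (l : 'I_n).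
Implicit Types (i : grid (n := n) k.+1).

Lemma sum_grid_coord (psi : 'I_k.+1 -> R) :
  \sum_(i : grid (n := n) k.+1) psi (i l) = k.+1%:R ^+ n.-1 * \sum_j psi j.
Proof.
pose F (x : 'I_n) (j : 'I_k.+1) := if x == l then psi j else 1.
transitivity (\sum_(i : grid (n := n) k.+1) \prod_x F x (i x)).
  apply: eq_bigr => i _; rewrite (bigD1 l)//= /F eqxx big1 ?mulr1// => x xl.
  by rewrite (negbTE xl).
rewrite -bigA_distr_bigA/= (bigD1 l)//= mulrC; congr (_ * _).
  rewrite (eq_bigr (fun=> k.+1%:R)) => [|x xl].
    rewrite prodr_const; congr (_ ^+ _).
    by rewrite -[in RHS](card_ord n) (cardC1 l).
  by rewrite /F (negbTE xl) sumr_const card_ord.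
by rewrite /F eqxx.
Qed.

Variable (m : nat).
Hypothesis mk : (m <= k.+1)%N.

(** Translation of the grid by [- m] cubes in the direction [l], made cyclic so
    that it permutes the grid; for the index [i] with [m <= i l] it moves the
    center by exactly [- m h], by [shift_downE]. *)
Definition shift_down i : grid (n := n) k.+1 :=
  [ffun x => if x == l then inord ((i x + (k.+1 - m)) %% k.+1) else i x].

Lemma shift_down_inj : injective shift_down.
Proof.
move=> i j /ffunP ij; apply/ffunP => x; have := ij x; rewrite !ffunE.
case: ifP => // _ /(congr1 val)/=; rewrite !inordK ?ltn_pmod// => /eqP.
by rewrite eqn_modDr !modn_small// => /eqP /val_inj.
Qed.

Lemma shift_downE i : (m <= i l)%N -> Defs.center a b (shift_down i) =
  Defs.center a b i - (m%:R * ((b - a) / k.+1%:R)) *: delta_mx 0 l.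
Proof.
move=> mi; apply/rowP => x; rewrite !mxE ffunE /=; case: ifP => [/eqP ->|_].
  have E : ((i l + (k.+1 - m)) %% k.+1 = i l - m)%N.
    rewrite addnBA// addnC -addnBA// modnDl modn_small//.
    by rewrite (leq_ltn_trans (leq_subr _ _)).
  rewrite inordK ?ltn_pmod// E natrB//; rewrite mulr1n; ring.
by rewrite mulr0n mulr0 subr0.
Qed.

Variables (f : 'rV[R]_n -> R) (M : R).
Hypothesis ab : a < b.
Hypothesis M0 : 0 <= M.
Hypothesis fM : forall (x y : 'rV[R]_n) (d : R), 0 <= d ->
  (forall x', `|x 0 x' - y 0 x'| <= d) -> `|f x - f y| <= M * d.

Let s := m%:R * ((b - a) / k.+1%:R).
Let e : 'rV[R]_n := s *: delta_mx 0 l.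

Let s0 : 0 <= s.
Proof. by rewrite mulr_ge0// divr_ge0// subr_ge0 ltW. Qed.

Lemma increment_le x : `|f (x + e) - f x| <= M * s.
Proof.
apply: fM => // j; rewrite !mxE addrAC subrr add0r eqxx /=.
by case: eqP => _; rewrite ?mulr1n ?mulr0n ?mulr1 ?mulr0 ?normr0// ger0_norm.
Qed.

(** A second difference is the increment of [f] at [c] minus the increment at
    [c - e].  Since [shift_down] permutes the grid, the sums of the two cancel
    except for the [m] layers of cubes where the translation wraps around; there
    each increment is at most [M * s], which is of the order of the step. *)
Lemma second_difference_sum :
  \sum_(i : grid (n := n) k.+1) (f (Defs.center a b i + e)
    - 2 * f (Defs.center a b i) + f (Defs.center a b i - e)) <=
  k.+1%:R ^+ n.-1 * m%:R * (2 * (M * s)).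
Proof.
pose c i := Defs.center a b (k := k.+1) i.
pose g x := f (x + e) - f x.
have -> : \sum_(i : grid (n := n) k.+1) (f (c i + e) - 2 * f (c i) + f (c i - e))
  = \sum_(i : grid (n := n) k.+1) (g (c (shift_down i)) - g (c i - e)).
  have E : \sum_i g (c i) = \sum_i g (c (shift_down i)).
    by rewrite (reindex_inj shift_down_inj).
  rewrite sumrB -E -sumrB /g; apply: eq_bigr => i _.
  by rewrite subrK; ring.
apply: (@le_trans _ _ (\sum_(i : grid (n := n) k.+1)
    (fun j : 'I_k.+1 => if (j < m)%N then 2 * (M * s) else 0) (i l))).
  apply: ler_sum => i _; case: ifPn => [_|].
    have := increment_le (c (shift_down i)); have := increment_le (c i - e).
    rewrite -/(g _) -/(g _) !ler_norml => /andP[? ?] /andP[? ?]; lra.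
  by rewrite -leqNgt => mi; rewrite /c shift_downE// subrr.
rewrite (sum_grid_coord (fun j : 'I_k.+1 =>
  if (j < m)%N then 2 * (M * s) else 0)) -big_mkcond/= sumr_const -mulrA.
have Ms0 : 0 <= 2 * (M * s) by rewrite mulr_ge0// mulr_ge0.
rewrite ler_wpM2l ?exprn_ge0// -[leLHS]mulr_natl ler_wpM2r//.
have inj : injective (widen_ord mk) by move=> x y /(congr1 val)/= /val_inj.
rewrite ler_nat -[leqRHS](card_ord m) -(fintype.card_image inj).
apply: subset_leq_card; apply/fintype.subsetP => j jm.
by apply/fintype.imageP; exists (Ordinal jm) => //; exact: val_inj.
Qed.

End grid_sums.

(** * The value of the maximum of affine functions *)

Section subgradients.
Context {R : realType} {n : nat}.
Variables (f : 'rV[R]_n -> R) (M : R).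
Hypothesis fM : forall (x y : 'rV[R]_n) (d : R), 0 <= d ->
  (forall j, `|x 0 j - y 0 j| <= d) -> `|f x - f y| <= M * d.

(** For a convex function, subgradients at nearby points need not be close, but
    their distance is controlled by a second difference: the subgradient [g]
    at [x] is bounded above by the increment of [f] at [x] in the direction [l],
    the subgradient [p] at [c] is bounded below by the backward increment at [c],
    and moving from [x] to [c] costs [M * d] twice.  The same holds with the
    roles of the two directions exchanged. *)
Lemma subgradient_dist (x c g p : 'rV[R]_n) (l : 'I_n) (d s : R) :
  0 <= d -> (forall j, `|x 0 j - c 0 j| <= d) ->
  (forall y, dotv g (y - x) <= f y - f x) ->
  (forall y, dotv p (y - c) <= f y - f c) ->
  s * `|g 0 l - p 0 l| <= (f (c + s *: delta_mx 0 l) - 2 * f c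
    + f (c - s *: delta_mx 0 l)) + 2 * (M * d).
Proof.
move=> d0 xc gx pc; set e := s *: delta_mx 0 l.
have ge : dotv g e = s * g 0 l by rewrite dotvZr dotv_delta.
have pe : dotv p e = s * p 0 l by rewrite dotvZr dotv_delta.
have cancel (w z : 'rV[R]_n) : w + z - w = z by rewrite addrAC subrr add0r.
have := gx (x + e); have := gx (x - e); have := pc (c + e); have := pc (c - e).
rewrite !cancel !dotvNr ge pe => h1 h2 h3 h4.
have := fM d0 xc.
have : `|f (x + e) - f (c + e)| <= M * d.
  by apply: fM => // j; rewrite !mxE opprD addrACA subrr addr0.
have : `|f (x - e) - f (c - e)| <= M * d.
  by apply: fM => // j; rewrite !mxE opprB addrA subrK.
rewrite !ler_norml => /andP[? ?] /andP[? ?] /andP[? ?].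
have [gp|gp] := leP 0 (g 0 l - p 0 l); [rewrite ger0_norm//|rewrite ltr0_norm//];
  by rewrite ?mulrN mulrBr; lra.
Qed.

End subgradients.

Section continuous_le_discrete.
Context {R : realType} {n : nat}.
Variables (a b : R) (Q : set 'rV[R]_n) (C : 'rV[R]_n -> R).
Hypothesis ab : a < b.
Hypothesis Q_compact : compact Q.
Hypothesis C_convex : strictly_convex C.
Hypothesis C_diff : forall x, differentiable C x.

(** [C] is Lipschitz where its gradient is bounded: the subgradient inequality
    at [g] alone gives the one-sided estimate that is needed. *)
Lemma strictly_convex_le (g p : 'rV[R]_n) (K : R) : l1norm (grad C g) <= K ->
  C g <= C p + K * l1norm (g - p).
Proof.
move=> gK; have [->|gp] := eqVneq p g.
  by rewrite lerDl mulr_ge0 ?l1norm_ge0// (le_trans (l1norm_ge0 _) gK).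
have := @subgradient_grad _ _ C g p (C_diff g) (fun t t01 => ltW (C_convex gp t01)).
have : `|dotv (grad C g) (p - g)| <= l1norm (grad C g) * l1norm (g - p).
  apply: dotv_le => j; rewrite -normrN.
  by have := coord_le_l1norm (g - p) j; rewrite !mxE opprB.
have : l1norm (grad C g) * l1norm (g - p) <= K * l1norm (g - p).
  by rewrite ler_wpM2r ?l1norm_ge0.
by rewrite ler_norml => ? /andP[? ?] ?; lra.
Qed.

Let C_cont : continuous C.
Proof. by move=> x; exact: differentiable_continuous. Qed.

(** The two Lagrangians at a point of a cube and at its center differ by at most
    [M * h] (value and linear term) plus a multiple of the l1 distance between the
    gradient there and [D i].  The latter is bounded by [E i], which does not
    depend on the point of the cube, and the sum of the [E i] is bounded by
    [second_difference_sum] for each direction [l]. *)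
Lemma functional_max_affine_le k (v : grid (n := n) k.+1 -> R)
  (D : grid (n := n) k.+1 -> 'rV[R]_n) (M K : R) (m : nat) :
  feasible a b Q v D ->
  (forall q, Q q -> l1norm q <= M) ->
  (forall q, Q q -> l1norm (grad C q) <= K) ->
  (0 < m <= k.+1)%N ->
  functional a b C (max_affine a b v D) <= discrete_functional a b C v D +
    (b - a) ^+ n * (M * ((b - a) / k.+1%:R) +
      (`|a| + `|b| + K) * (n%:R * (2 * M * m%:R / k.+1%:R + M / m%:R))).
Proof.
move=> [v0 DQ vD] QM QK /andP[m0 mk].
set f := max_affine a b v D; set h := (b - a) / k.+1%:R.
set A : R := `|a| + `|b|.
pose c i := Defs.center a b (k := k.+1) (i : grid (n := n) k.+1).
have h0 : 0 < h by rewrite divr_gt0// subr_gt0.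
have d0 : 0 <= h / 2 by rewrite divr_ge0// ltW.
have M0 : 0 <= M by rewrite (le_trans (l1norm_ge0 (D [ffun=> ord0])))// QM.
have K0 : 0 <= K by rewrite (le_trans (l1norm_ge0 (grad C (D [ffun=> ord0]))))// QK.
have A0 : 0 <= A by rewrite addr_ge0.
have fM (x y : 'rV[R]_n) (d : R) : 0 <= d -> (forall j, `|x 0 j - y 0 j| <= d) ->
    `|f x - f y| <= M * d.
  by apply: max_affine_Lipschitz => i; exact: QM.
have fc i : f (c i) = v i by exact: max_affine_center.
have gf := max_affine_grad_ae a b v DQ.
have f_cont : {within Theta a b, continuous f}.
  exact/continuous_subspaceT/max_affine_continuous.
have [G [F [KF [[mG GP] nT [mF FK] FE FI]]]] :=
  lagrangian_representation ab Q_compact C_cont f_cont gf.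
have nG i : lebesgue_rV n (cell a b (i : grid (n := n) k.+1) `\` G) = 0%E.
  exact: null_cell.
pose s := m%:R * h.
have s0 : 0 < s by rewrite mulr_gt0// ltr0n.
pose Delta i l := f (c i + s *: delta_mx 0 l) - 2 * f (c i)
    + f (c i - s *: delta_mx 0 l).
pose E i := \sum_(l < n) (Delta i l + 2 * (M * (h / 2))) / s.
have cell_le i x : cell a b i x -> G x ->
    F x <= lagrangian C (c i) (v i) (D i) + (M * h + (A + K) * E i).
  move=> ix Gx; rewrite FE//; have [Tx df Qx] := GP _ Gx.
  set g := grad f x.
  have xc j : `|x 0 j - c i 0 j| <= h / 2 by exact: cell_center.
  have gx y : dotv g (y - x) <= f y - f x.
    apply: subgradient_grad => // t /andP[t0 t1]; apply: max_affine_convex.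
    by rewrite !ltW.
  have pc y : dotv (D i) (y - c i) <= f y - f (c i).
    by apply: max_affine_subgradient; rewrite -/f fc affine_piece_center.
  have gpE : l1norm (g - D i) <= E i.
    apply: ler_sum => l _; rewrite ler_pdivlMr// mulrC.
    have -> : (g - D i) 0 l = g 0 l - D i 0 l.
      by rewrite [LHS]mxE [(- D i) 0 l]mxE.
    exact: (subgradient_dist fM l s d0 xc gx pc).
  have Cg := strictly_convex_le (D i) (QK _ Qx).
  have fx := fM _ _ _ d0 xc.
  have xg : `|dotv g (x - c i)| <= M * (h / 2).
    apply: (@le_trans _ _ (l1norm g * (h / 2))).
      apply: dotv_le => l; have := xc l.
      by rewrite [(x - c i) 0 l]mxE [(- c i) 0 l]mxE.
    by rewrite ler_wpM2r// QM.
  have cgp : `|dotv (g - D i) (c i)| <= E i * A.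
    apply: (@le_trans _ _ (l1norm (g - D i) * A)); last by rewrite ler_wpM2r.
    apply: dotv_le => l.
    have ci : cell a b i (c i).
      move=> j; rewrite mxE -/h -[(i j).+1%:R]natr1.
      by apply/andP; split; lra.
    exact: Theta_bound (cell_sub ab ci) l.
  have KE : K * l1norm (g - D i) <= K * E i by rewrite ler_wpM2l.
  move: fx xg cgp; rewrite fc !ler_norml => /andP[? ?] /andP[? ?] /andP[? ?].
  rewrite /lagrangian -/g ![dotv _ g]dotvC ![dotv _ (D i)]dotvC.
  move: Cg KE; move: (l1norm _) => lg Cg KE.
  have : dotv g (x - c i) = dotv g x - dotv g (c i) by rewrite dotvBr.
  have : dotv (g - D i) (c i) = dotv g (c i) - dotv (D i) (c i) by rewrite dotvBl.
  by rewrite mulrDl [A * _]mulrC; lra.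
pose vol := cube_volume (n := n) a b k.+1.
have vol0 : 0 < vol by exact: cube_volume_gt0.
have int_le i : \int[lebesgue_rV n]_(x in cell a b i) F x <=
    vol * (lagrangian C (c i) (v i) (D i) + (M * h + (A + K) * E i)).
  have mc := measurable_cell a b i.
  have mcG : measurable (cell a b i `&` G) by exact: measurableI.
  have cG : lebesgue_rV n (cell a b i `\` (cell a b i `&` G)) = 0%E.
    by rewrite setDIr setDv set0U nG.
  have mucG : lebesgue_rV n (cell a b i `&` G) = vol%:E.
    rewrite -[RHS](lebesgue_cell ab i).
    exact: measure_setD_null mc mcG (@subIsetl _ _ _) cG.
  rewrite (Rintegral_setD_null _ _ _ mc mcG (@subIsetl _ _ _) cG).
  rewrite mulrC -[vol]/(fine vol%:E) -mucG.
  rewrite -(Rintegral_cst (lebesgue_rV n) mcG).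
  apply: le_Rintegral => //.
  - exact: integrableS mc mcG (@subIsetl _ _ _) (integrable_cell ab mF FK i).
  - apply: (bounded_integrable mcG mucG) => // x _; exact: lexx.
  - by move=> x [ix Gx]; exact: cell_le.
rewrite (FI k).
apply: (le_trans (ler_sum _ (fun i _ => int_le i))).
pose N : R := #|grid (n := n) k.+1|%:R.
pose P : R := k.+1%:R ^+ n.-1.
have k0 : k.+1%:R != 0 :> R by rewrite pnatr_eq0.
have m_neq0 : m%:R != 0 :> R by rewrite pnatr_eq0 -lt0n.
have sumE_le : \sum_i E i <=
    N * (n%:R * (2 * M * m%:R / k.+1%:R + M / m%:R)).
  rewrite /E exchange_big/= [leRHS]mulrCA [leRHS]mulr_natl.
  set X := N * _; have -> : X *+ n = \sum_(l < n) X by rewrite sumr_const card_ord.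
  apply: ler_sum => l _; rewrite /X.
  rewrite -mulr_suml ler_pdivrMr// big_split/= sumr_const.
  rewrite -[_ *+ _]mulr_natl -/N.
  have NP : N = k.+1%:R * P.
    rewrite /N /P card_ffun !card_ord natrX -exprS prednK//.
    exact: leq_ltn_trans (ltn_ord l).
  have := second_difference_sum l mk ab M0 fM.
  rewrite -/h -/s -/P => Dsum.
  rewrite (_ : N * (2 * M * m%:R / k.+1%:R + M / m%:R) * s =
    P * m%:R * (2 * (M * s)) + N * (2 * (M * (h / 2)))); first by rewrite lerD2r.
  rewrite mulrDr mulrDl; congr (_ + _).
    by rewrite NP; field.
  by rewrite /s; field.
have -> : \sum_i vol * (lagrangian C (c i) (v i) (D i) + (M * h + (A + K) * E i))
    = vol * \sum_i lagrangian C (c i) (v i) (D i) +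
      vol * (N * (M * h) + (A + K) * \sum_i E i).
  rewrite -mulr_sumr big_split/= mulrDr; congr (_ + vol * _).
  by rewrite big_split/= sumr_const -mulr_sumr -[_ *+ #|_|]mulr_natl.
rewrite lerD2l -(cube_volume_sum a b k) -/vol -/N -mulrA ler_pM2l//.
rewrite mulrDr lerD2l mulrCA ler_wpM2l// addr_ge0//.
Qed.

End continuous_le_discrete.

(** * Comparison with the minimum of the continuous problem *)

Section lower_bound.
Context {R : realType} {n : nat}.
Variables (a b : R) (Q : set 'rV[R]_n) (C : 'rV[R]_n -> R).
Hypothesis ab : a < b.
Hypothesis Q_compact : compact Q.
Hypothesis C_cont : continuous C.

Lemma near_center k (x : 'rV[R]_n) : Theta a b x ->
  exists i : grid (n := n) k.+1,
    forall l, `|x 0 l - Defs.center a b i 0 l| <= (b - a) / k.+1%:R.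
Proof.
move=> Tx; set h := (b - a) / k.+1%:R.
have h0 : 0 < h by rewrite divr_gt0// subr_gt0.
have hb : h <= b - a.
  by rewrite ler_pdivrMr// ler_peMr ?ler1n// subr_ge0 ltW.
(* The upper faces of Theta are in no cube: points there are first moved inside
   by half a side. *)
pose x' : 'rV[R]_n := \row_l (if x 0 l == b then b - h / 2 else x 0 l).
have [i ix'] : exists i : grid (n := n) k.+1, cell a b i x'.
  apply: cell_cover => // l; rewrite mxE; have /andP[al lb] := Tx l.
  case: eqVneq => [_|xb]; last by rewrite al lt_neqAle xb.
  by apply/andP; split; lra.
exists i => l; have := cell_center ix' l; rewrite -/h {1}/x' mxE.
case: eqVneq => [->|_]; last by move/le_trans; apply; lra.
by move: (Defs.center _ _ _ _ _) => c; rewrite !ler_norml => /andP[? ?];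
  apply/andP; split; lra.
Qed.

Lemma functional_subC (f : 'rV[R]_n -> R) (m : R) :
  {within Theta a b, continuous f} ->
  {ae lebesgue_rV n, forall x, Theta a b x -> differentiable f x /\ Q (grad f x)} ->
  functional a b C (fun x => f x - m) = functional a b C f - m * (b - a) ^+ n.
Proof.
move=> cf gf.
have [G [F [K [[mG GP] nT [mF FK] FE FI]]]] :=
  lagrangian_representation ab Q_compact C_cont cf gf.
have mT := measurable_Theta (n := n) a b.
have GT : G `<=` Theta a b by move=> x /GP[].
have muG : lebesgue_rV n G = ((b - a) ^+ n)%:E.
  rewrite -[RHS](lebesgue_Theta ab).
  exact: measure_setD_null mT mG GT nT.
have iF (g : 'rV[R]_n -> R) (K' : R) : measurable_fun setT g ->
    (forall x, `|g x| <= K') -> (lebesgue_rV n).-integrable G (EFin \o g).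
  move=> mg gK; apply: (bounded_integrable mG muG _ (fun x _ => gK x)).
  exact: measurable_funTS.
rewrite /functional !(Rintegral_setD_null _ _ _ mT mG GT nT).
transitivity (\int[lebesgue_rV n]_(x in G) (F x - (fun=> m) x)).
  apply: eq_Rintegral => x /set_mem Gx; rewrite FE// gradB_cst /lagrangian; lra.
rewrite RintegralB//; first last.
- by apply: (iF (fun=> m) `|m|).
- exact: iF FK.
rewrite Rintegral_cst// [X in fine X]muG /=; congr (_ - _).
by apply: eq_Rintegral => x /set_mem Gx; rewrite FE.
Qed.

(** The maximum of the affine pieces misses admissibility only by its minimum over
    Theta: it may be negative between the centers and the boundary of Theta, and
    need not vanish anywhere.  Subtracting the minimum repairs both. *)
Lemma functional_max_affine_ge (u : 'rV[R]_n -> R) k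
  (v : grid (n := n) k.+1 -> R) (D : grid (n := n) k.+1 -> 'rV[R]_n) (M : R) :
  (forall f, admissible a b Q f -> functional a b C u <= functional a b C f) ->
  feasible a b Q v D -> (forall q, Q q -> l1norm q <= M) ->
  functional a b C u <= functional a b C (max_affine a b v D) +
    M * ((b - a) / k.+1%:R) * (b - a) ^+ n.
Proof.
move=> umin [v0 DQ vD] QM.
set f := max_affine a b v D; set h := (b - a) / k.+1%:R.
have h0 : 0 <= h by rewrite divr_ge0// subr_ge0 ltW.
have f_cont : {within Theta a b, continuous f}.
  exact/continuous_subspaceT/max_affine_continuous.
have gf := max_affine_grad_ae a b v DQ.
have T0 : (Theta a b : set 'rV[R]_n) !=set0.
  by exists (const_mx a) => i; rewrite mxE lexx ltW.
have [x0 /set_mem Tx0 x0min] := EVT_min_rV T0 (@compact_Theta R n a b) f_cont.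
have adm : admissible a b Q (fun x => f x - f x0).
  split.
  - move=> x; apply: (@continuousB _ _ _ (f : subspace (Theta a b) -> R)).
      exact: f_cont.
    exact: cst_continuous.
  - move=> t x y _ _; rewrite convRE.
    have t01 : 0 <= t%:num <= 1 by apply/andP; split.
    have fxy : f (conv t x y) <= t%:num * f x + (1 - t%:num) * f y.
      exact: max_affine_convex.
    by rewrite /unstable.onem; lra.
  - by move=> x Tx; rewrite subr_ge0; apply: x0min; exact: mem_set.
  - apply: filterS gf => x + Tx => /(_ Tx)[df Qx].
    rewrite gradB_cst; split => //.
    by apply: (@differentiableB _ _ _ f (cst (f x0))) => //.
  - by exists x0 => //; rewrite subrr.
have := umin _ adm; rewrite functional_subC// => /le_trans; apply.
rewrite lerD2l -mulNr; apply: ler_wpM2r.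
  by rewrite exprn_ge0// subr_ge0 ltW.
rewrite lerNl.
have [i ix] := near_center k Tx0.
have : `|f x0 - f (Defs.center a b i)| <= M * h.
  by apply: max_affine_Lipschitz => // j; exact: QM.
rewrite [f (Defs.center _ _ _)]max_affine_center// ler_norml.
by have := v0 i; lra.
Qed.

End lower_bound.

(* The k-th discretization has k.+1 subdivisions per axis, so that the sequence
   ranges over the positive integers. *)
Theorem theorem3p9 (R : realType) (n : nat) (n_gt0 : (0 < n)%N)
  (a b : R) (ab : a < b)
  (Q : set 'rV[R]_n) (Q_neq0 : Q !=set0) (Q_convex : convex_set Q)
  (Q_compact : compact Q)
  (C : 'rV[R]_n -> R) (C_convex : strictly_convex C) (C_C1 : C1 C)
  (ubar : 'rV[R]_n -> R) (ubar_sol : unique_solution a b Q C ubar)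
  (v : forall k : nat, grid (n := n) k.+1 -> R)
  (D : forall k : nat, grid (n := n) k.+1 -> 'rV[R]_n)
  (vD_sol : forall k : nat, discrete_solution a b Q C (v k) (D k)) :
  (fun k : nat => functional a b C (max_affine a b (v k) (D k))) @ \oo -->
    functional a b C ubar
  /\ functional a b C ubar = inf [set functional a b C f | f in admissible a b Q].
Proof.
have [[u_adm u_min] _] := ubar_sol.
have [C_diff C_grad] := C_C1.
have C_cont : continuous C by move=> x; exact: differentiable_continuous.
split; last first.
  apply/eqP; rewrite eq_le; apply/andP; split.
    apply: lb_le_inf; first by exists (functional a b C ubar), ubar.
    by move=> _ [f f_adm <-]; exact: u_min.
  apply: ge_inf; last by exists ubar.
  by exists (functional a b C ubar) => _ [f f_adm <-]; exact: u_min.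
have [M M0 QM] := l1norm_bounded Q_compact (fun x => cvg_id).
have [K K0 QK] := l1norm_bounded Q_compact C_grad.
set I := functional a b C ubar.
pose V := (b - a) ^+ n.
pose B := (`|a| + `|b| + K) * n%:R.
have V0 : 0 <= V by rewrite exprn_ge0// subr_ge0 ltW.
have B0 : 0 <= B by rewrite mulr_ge0// !addr_ge0.
apply/cvgrPdist_le => /= e e0.
(* The step [s = (m + 1) h] of the second differences: [m] is chosen first, to
   make the term [M / (m + 1)] small uniformly in [k]. *)
have [m me] : exists m, V * B * M / m.+1%:R <= e / 2.
  have [m mlt] : exists m, (V * B * M) / (e / 2) < m.+1%:R.
    exists (Num.truncn ((V * B * M) / (e / 2))).
    by have /andP[] := truncn_itv (divr_ge0 (mulr_ge0 (mulr_ge0 V0 B0) M0)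
      (divr_ge0 (ltW e0) (ler0n _ 2))).
  by exists m; rewrite ler_pdivrMr// [leRHS]mulrC -ler_pdivrMr ?divr_gt0// ltW.
pose W := V * (2 * M * (b - a) + B * (2 * M * m.+1%:R)).
have W_cvg : (fun k => W * harmonic k) @ \oo --> (0 : R).
  by rewrite -[X in _ --> X](mulr0 W); apply: cvgMr; exact: cvg_harmonic.
near=> k.
have Wk : W * harmonic k <= e / 2.
  by near: k; apply: (cvgr_le _ W_cvg); rewrite divr_gt0.
have mk : (0 < m.+1 <= k.+1)%N.
  by rewrite ltn0Sn ltnS; near: k; exact: nbhs_infty_ge.
have vDf : feasible a b Q (v k) (D k) by have [] := vD_sol k.
have ge := functional_max_affine_ge ab Q_compact C_cont u_min vDf QM.
have le := functional_max_affine_le ab Q_compact C_convex C_diff vDf QM QK mk.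
have sample := discrete_le_functional ab Q_compact C_cont (vD_sol k) u_adm QM.
rewrite -/I in ge sample.
move: ge le sample; set J := discrete_functional _ _ _ _ _.
set If := functional _ _ _ _.
have x0 : 0 <= V * (M * (b - a)) / k.+1%:R.
  by rewrite divr_ge0// mulr_ge0// mulr_ge0// subr_ge0 ltW.
have y0 : 0 <= V * (B * (2 * M * m.+1%:R)) / k.+1%:R.
  by rewrite divr_ge0// mulr_ge0// mulr_ge0// mulr_ge0// mulr_ge0.
move: Wk me x0 y0; rewrite /W /B /= -/V.
move: (m.+1%:R : R) (k.+1%:R^-1) (m.+1%:R^-1) => m1 hk hm *.
by rewrite ler_norml; apply/andP; split; lra.
Unshelve. all: by end_near. Qed.
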